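(* Let $k$ be a field of characteristic $p>0$. For every tuple $E=(G,a,c,\alpha)$ the Hopf algebra $H_E$ over $k$ is pointed, of rank one, and of third type.
   Context: For a finite-dimensional Hopf algebra $H$ over $k$: $G(H)$ is the group of group-like elements; the coradical $H_0$ is the sum of the simple subcoalgebras; $H_1=\Delta^{-1}(H\otimes H_0+H_0\otimes H)$. $H$ is pointed if all simple subcoalgebras are one-dimensional, so that $H_0=kG(H)$. For $g,h\in G(H)$, $P_{g,h}=\{c\in H:\Delta(c)=c\otimes g+h\otimes c\}$. An element $a\in G(H)$ is a skew point if $P_{a,1}\setminus H_0\neq\emptyset$. A pointed $H$ has rank $t$ if $\dim_k k\otimes_{H_0}H_1=t+1$ ($k$ trivial via the counit). A pointed rank one Hopf algebra has exactly one skew point $a$. A finite-dimensional pointed rank one Hopf algebra $H$ generated as an algebra by $H_1$, with skew point $a$, is of third type if $a\ne1$ and there is $x\in P_{a,1}\setminus H_0$ with $axa^{-1}=x+(a-1)$. Third type $H_E$. Let $E=(G,a,c,\alpha)$ where $G$ is a finite group, $a\in Z(G)$ has order divisible by $p$, $c:G\to(k,+)$ is a group homomorphism with $c(a)=1$, $\alpha\in k$, and, if $a^p\neq1$, $c(g)\in\mathbb{F}_p$ for all $g\in G$. $H_E$ is the algebra containing $kG$ and an element $x$, with basis $(gx^i)_{g\in G,\,0\le i\le p-1}$ and relations $gxg^{-1}=x+c(g)(a-1)$ ($g\in G$), $x^p=x+\alpha(a^p-1)$; its Hopf structure is $\Delta(gx^i)=(g\otimes g)(x\otimes a+1\otimes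 x)^i$, $\epsilon(gx^i)=\delta_{i,0}$, $S(gx^i)=(-xa^{-1})^ig^{-1}$. *)

(* Defs.v *)
From HB Require Import structures.
From mathcomp Require Import all_boot all_order all_fingroup all_algebra all_solvable all_field.
From mathcomp Require Import boolp classical_sets.
Set Implicit Arguments.
Unset Strict Implicit.
Unset Printing Implicit Defensive.
Import GRing.Theory.
Local Open Scope ring_scope.

Section SpanOfSet.
Variables (k : fieldType) (V : vectType k).
Implicit Types (S : set V) (U W : {vspace V}).

Definition is_vspan S U : Prop :=
  (forall v, S v -> v \in U) /\
  (forall W, (forall v, S v -> v \in W) -> (U <= W)%VS).

(* The smallest subspace containing an arbitrary, possibly infinite, set of
   vectors; [vspanP] shows that the default value 0 is never used. *)
Definition vspan S : {vspace V} := xget 0%VS [set U | is_vspan S U]%classic.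

Lemma vspanP S : is_vspan S (vspan S).
Proof.
apply: (@xgetPex _ _ [set U | is_vspan S U]%classic).
pose P n := `[< exists2 U : {vspace V}, (forall v, S v -> v \in U) & \dim U = n >].
have exP : exists n, P n.
  by exists (\dim (fullv : {vspace V})); apply/asboolP; exists fullv => // v _; rewrite memvf.
case: (ex_minnP exP) => n /asboolP [U SU dimU] minU.
exists U; split=> // W SW; apply/capv_idPl/eqP.
rewrite eqEdim capvSl dimU; apply: minU; apply/asboolP.
by exists (U :&: W)%VS => // v Sv; rewrite memv_cap SU ?SW.
Qed.

Lemma memv_vspan S v : S v -> v \in vspan S.
Proof. by case: (vspanP S) => + _; apply. Qed.

Lemma vspan_sub S W : (forall v, S v -> v \in W) -> (vspan S <= W)%VS.
Proof. by case: (vspanP S) => _; apply. Qed.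

End SpanOfSet.

(* The tensor product of two finite-dimensional spaces, as the space of
   coordinate matrices on the basis of the products of the basis vectors
   [vbasis fullv] of the factors.  [tens u v] is the pure tensor; [tlift f] is
   the linear map induced by a bilinear [f], and [tliftE], [tlift_uniq] are the
   universal property. *)
Definition tensor (k : fieldType) (U V : vectType k) : Type :=
  'M[k]_(\dim (fullv : {vspace U}), \dim (fullv : {vspace V})).

HB.instance Definition _ (k : fieldType) (U V : vectType k) :=
  Vector.copy (tensor U V)
    'M[k]_(\dim (fullv : {vspace U}), \dim (fullv : {vspace V})).

Section Tensor.
Variables (k : fieldType) (U V : vectType k).

Definition tens (u : U) (v : V) : tensor U V :=
  \matrix_(i, j) (coord (vbasis fullv) i u * coord (vbasis fullv) j v).

Lemma tens_is_linear_l v : linear (tens^~ v).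
Proof.
by move=> a u u'; apply/matrixP => i j; rewrite !mxE linearP mulrDl -mulrA.
Qed.

Lemma tens_is_linear_r u : linear (tens u).
Proof.
by move=> a v v'; apply/matrixP => i j; rewrite !mxE linearP mulrDr mulrCA.
Qed.

Definition tlift_fun (W : vectType k) (f : U -> V -> W) (t : tensor U V) : W :=
  \sum_i \sum_j t i j *: f (vbasis fullv)`_i (vbasis fullv)`_j.

Lemma tlift_fun_is_linear (W : vectType k) (f : U -> V -> W) :
  linear (tlift_fun f).
Proof.
move=> a s t; rewrite /tlift_fun scaler_sumr -big_split; apply: eq_bigr => i _.
rewrite scaler_sumr -big_split; apply: eq_bigr => j _ /=.
by rewrite !mxE scalerDl scalerA.
Qed.

HB.instance Definition _ (W : vectType k) (f : U -> V -> W) :=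
  GRing.isLinear.Build k (tensor U V) W _ (tlift_fun f) (tlift_fun_is_linear f).

Definition tlift (W : vectType k) (f : U -> V -> W) : 'Hom(tensor U V, W) :=
  linfun (tlift_fun f).

Lemma tliftE (W : vectType k) (f : U -> V -> W) u v :
  (forall v, linear (f^~ v)) -> (forall u, linear (f u)) ->
  tlift f (tens u v) = f u v.
Proof.
move=> fl fr; rewrite lfunE /= /tlift_fun.
pose Fl v := GRing.isLinear.Build _ _ _ _ (f^~ v) (fl v).
pose fL v : {linear U -> W} := HB.pack (f^~ v) (Fl v).
pose Fr u := GRing.isLinear.Build _ _ _ _ (f u) (fr u).
pose fR u : {linear V -> W} := HB.pack (f u) (Fr u).
have -> : f u v = fL v u by [].
rewrite {2}(coord_vbasis (memvf u)) linear_sum; apply: eq_bigr => i _.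
rewrite linearZ /=; set e := _`_i; have -> : f e v = fR e v by [].
rewrite {2}(coord_vbasis (memvf v)) linear_sum scaler_sumr.
by apply: eq_bigr => j _; rewrite linearZ mxE scalerA.
Qed.

Lemma coord_vbasis_nth (i j : 'I_(\dim (fullv : {vspace U}))) :
  coord (vbasis (fullv : {vspace U})) i (vbasis fullv)`_j = (i == j)%:R.
Proof. by rewrite coord_free ?(basis_free (vbasisP _)) // eq_sym. Qed.

End Tensor.

Lemma tensorE (k : fieldType) (U V : vectType k) (t : tensor U V) :
  t = \sum_i \sum_j t i j *: tens (vbasis fullv)`_i (vbasis fullv)`_j.
Proof.
rewrite {1}[t]matrix_sum_delta; apply: eq_bigr => i _; apply: eq_bigr => j _.
congr (_ *: _); apply/matrixP => i' j'.
by rewrite !mxE !coord_vbasis_nth -natrM mulnb.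
Qed.

Lemma tlift_uniq (k : fieldType) (U V W : vectType k) (f g : 'Hom(tensor U V, W)) :
  (forall u v, f (tens u v) = g (tens u v)) -> f = g.
Proof.
move=> fg; apply/lfunP => t; rewrite (tensorE t) !linear_sum.
apply: eq_bigr => i _; rewrite !linear_sum; apply: eq_bigr => j _.
by rewrite !linearZ /= fg.
Qed.

Section TensorMaps.
Variable k : fieldType.
Implicit Types U V W : vectType k.

(* f (x) g *)
Definition tmap U V U' V' (f : 'Hom(U, U')) (g : 'Hom(V, V')) :
    'Hom(tensor U V, tensor U' V') :=
  tlift (fun u v => tens (f u) (g v)).

(* (u (x) v) (x) w |-> u (x) (v (x) w) *)
Definition tassoc U V W :
    'Hom(tensor (tensor U V) W, tensor U (tensor V W)) :=
  tlift (fun t w => tlift (fun u v => tens u (tens v w)) t).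

(* A (x) B as a subspace of U (x) V *)
Definition tensv U V (A : {vspace U}) (B : {vspace V}) :
    {vspace tensor U V} :=
  vspan [set t | exists u v, [/\ u \in A, v \in B & t = tens u v]]%classic.

End TensorMaps.

Section TensorAlgebra.
Variables (k : fieldType) (A B : falgType k).

Definition tmul (s t : tensor A B) : tensor A B :=
  tlift (fun a b => tlift (fun a' b' => tens (a * a') (b * b')) t) s.

Lemma tmul_tens a b a' b' :
  tmul (tens a b) (tens a' b') = tens (a * a') (b * b').
Proof.
have inner c d : tlift (fun a' b' => tens (c * a') (d * b')) (tens a' b')
    = tens (c * a') (d * b').
  apply: tliftE => [y|x] q z z'.
    by rewrite mulrDr -scalerAr tens_is_linear_l.
  by rewrite mulrDr -scalerAr tens_is_linear_r.
rewrite /tmul tliftE ?inner // => [y|x] q z z'; rewrite !inner.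
  by rewrite mulrDl -scalerAl tens_is_linear_l.
by rewrite mulrDl -scalerAl tens_is_linear_r.
Qed.

Lemma tmul_linear_l t : linear (tmul^~ t).
Proof. by move=> q s s'; rewrite /tmul linearP. Qed.

Lemma tmul_linear_r s : linear (tmul s).
Proof.
move=> q t t'; rewrite /tmul !lfunE /= /tlift_fun scaler_sumr -big_split.
apply: eq_bigr => i _; rewrite scaler_sumr -big_split; apply: eq_bigr => j _ /=.
by rewrite linearP scalerDr !scalerA mulrC.
Qed.

Lemma tensor_ind (P : tensor A B -> Prop) :
  (forall q s t, P s -> P t -> P (q *: s + t)) -> (forall a b, P (tens a b)) ->
  forall t, P t.
Proof.
move=> Plin Ptens t.
have P0 : P 0.
  by have := Plin (-1) _ _ (Ptens 0 0) (Ptens 0 0); rewrite scaleN1r addNr.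
have PD s s' : P s -> P s' -> P (s + s') by move=> /Plin/[apply]/(_ 1); rewrite scale1r.
rewrite (tensorE t); apply: big_ind => // i _; apply: big_ind => // j _.
by rewrite -[X in P X]addr0; apply: Plin.
Qed.

Lemma tmulA : associative tmul.
Proof.
move=> s t r; elim/tensor_ind: s => [q s s' Hs Hs'|a b].
  by rewrite !tmul_linear_l Hs Hs'.
elim/tensor_ind: t => [q t t' Ht Ht'|a' b'].
  by rewrite tmul_linear_l !tmul_linear_r tmul_linear_l Ht Ht'.
elim/tensor_ind: r => [q r r' Hr Hr'|a'' b''].
  by rewrite !tmul_linear_r Hr Hr'.
by rewrite !tmul_tens !mulrA.
Qed.

Lemma tmul1t : left_id (tens 1 1) tmul.
Proof.
elim/tensor_ind => [q s t Hs Ht|a b]; first by rewrite tmul_linear_r Hs Ht.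
by rewrite tmul_tens !mul1r.
Qed.

Lemma tmult1 : right_id (tens 1 1) tmul.
Proof.
elim/tensor_ind => [q s t Hs Ht|a b]; first by rewrite tmul_linear_l Hs Ht.
by rewrite tmul_tens !mulr1.
Qed.

Lemma tmulDl : left_distributive tmul +%R.
Proof. by move=> s t r; have := tmul_linear_l r 1 s t; rewrite !scale1r. Qed.

Lemma tmulDr : right_distributive tmul +%R.
Proof. by move=> r s t; have := tmul_linear_r r 1 s t; rewrite !scale1r. Qed.

HB.instance Definition _ := GRing.Zmodule_isPzRing.Build (tensor A B)
  tmulA tmul1t tmult1 tmulDl tmulDr.

Lemma tens_mul a b a' b' :
  (tens a b : tensor A B) * tens a' b' = tens (a * a') (b * b').
Proof. exact: tmul_tens. Qed.

End TensorAlgebra.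

HB.mixin Record isHopf (k : fieldType) H of Falgebra k H := {
  comul : 'Hom(H, tensor H H);
  counit : 'Hom(H, k^o);
  antipode : 'End(H);
  comulA : forall h,
    tassoc H H H (tmap comul \1 (comul h)) = tmap \1 comul (comul h);
  counitl : forall h, tlift (fun u v => counit u *: v) (comul h) = h;
  counitr : forall h, tlift (fun u v => counit v *: u) (comul h) = h;
  comul1 : comul 1 = 1;
  comulM : forall g h, comul (g * h) = comul g * comul h;
  counit1 : counit 1 = 1;
  counitM : forall g h, counit (g * h) = counit g * counit h;
  antipodel : forall h,
    tlift (fun u v => antipode u * v) (comul h) = counit h *: 1;
  antipoder : forall h,
    tlift (fun u v => u * antipode v) (comul h) = counit h *: 1;
}.

#[short(type="hopfType")]
HB.structure Definition Hopf (k : fieldType) := {H of isHopf k H & Falgebra k H}.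

Section HopfNotions.
Variables (k : fieldType) (H : hopfType k).
Implicit Types (U : {vspace H}) (a c g h x : H).

Definition grouplike g : Prop := comul g = tens g g /\ counit g = 1.

Definition subcoalgebra U : Prop := (comul @: U <= tensv U U)%VS.

Definition simple_subcoalgebra U : Prop :=
  [/\ subcoalgebra U, U <> 0%VS &
      forall W, subcoalgebra W -> (W <= U)%VS -> W = 0%VS \/ W = U].

(* H_0: the span of the union of the simple subcoalgebras is their sum. *)
Definition coradical : {vspace H} :=
  vspan [set h | exists U, simple_subcoalgebra U /\ h \in U]%classic.

(* H_1 *)
Definition coradical1 : {vspace H} :=
  (comul @^-1: (tensv fullv coradical + tensv coradical fullv))%VS.

Definition pointed : Prop :=
  forall U, simple_subcoalgebra U -> \dim U = 1%N.

(* c \in P_{g,h} *)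
Definition skew_primitive g h c : Prop := comul c = tens c g + tens h c.

Definition skew_point a : Prop :=
  grouplike a /\ exists2 c, skew_primitive a 1 c & c \notin coradical.

(* The relations l h (x) v = l (x) h v, for l in k, h in H_0 and v in H_1;
   k (x)_{H_0} H_1 is the quotient of k (x) H_1 by their span.  When H is pointed
   H_0 = kG(H) is a subalgebra and H_1 an H_0-submodule of H, so that the span
   lies in k (x) H_1. *)
Definition balancing : {vspace tensor (k^o : vectType k) H} :=
  vspan [set t | exists (l : k^o) h v, [/\ h \in coradical, v \in coradical1
                 & t = tens (l * counit h) v - tens l (h * v)]]%classic.

(* dim (k (x)_{H_0} H_1) = t + 1 *)
Definition has_rank (t : nat) : Prop :=
  \dim (tensv (fullv : {vspace k^o}) coradical1) = (\dim balancing + t.+1)%N.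

Definition third_type : Prop :=
  [/\ pointed, has_rank 1%N, agenv coradical1 = fullv &
      exists a, [/\ skew_point a, a <> 1 &
        exists x, [/\ skew_primitive a 1 x, x \notin coradical
                    & a * x * a^-1 = x + (a - 1)]]].

End HopfNotions.

(* The tuple E = (G, a, c, alpha); alpha is arbitrary.  The prime field F_p of k
   is the set of the n%:R. *)
Definition third_datum (k : fieldType) (p : nat) (G : finGroupType)
    (a : G) (c : G -> k) : Prop :=
  [/\ (a \in 'Z([set: G]))%g,
      (p %| #[a]%g)%N,
      {morph c : g h / (g * h)%g >-> g + h},
      c a = 1 &
      (a ^+ p)%g <> 1%g -> forall g, exists n : nat, c g = n%:R].

(* H is the Hopf algebra H_E, with G embedded by inc and with generator x. *)
Record is_HE (k : fieldType) (p : nat) (G : finGroupType) (a : G) (c : G -> k)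
    (alpha : k) (H : hopfType k) (inc : G -> H) (x : H) : Prop := IsHE {
  HE_1 : inc 1%g = 1;
  HE_M : {morph inc : g h / (g * h)%g >-> g * h};
  HE_basis : basis_of fullv [seq inc g * x ^+ i | g <- enum G, i <- index_iota 0 p];
  HE_conj : forall g,
    inc g * x * inc g^-1%g = x + c g *: (inc a - 1);
  HE_pow : x ^+ p = x + alpha *: (inc (a ^+ p)%g - 1);
  HE_comul : forall g i, (i < p)%N ->
    comul (inc g * x ^+ i) =
      tens (inc g) (inc g) * (tens x (inc a) + tens 1 x) ^+ i;
  HE_counit : forall g i, (i < p)%N -> counit (inc g * x ^+ i) = (i == 0)%:R;
  HE_antipode : forall g i, (i < p)%N ->
    antipode (inc g * x ^+ i) = (- (x * inc a^-1%g)) ^+ i * inc g^-1%g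
}.

(* Main.v *)
Require Import Defs.
From HB Require Import structures.
From mathcomp Require Import all_boot all_order all_fingroup all_algebra all_solvable all_field.
From mathcomp Require Import boolp classical_sets.
Set Implicit Arguments.
Unset Strict Implicit.
Unset Printing Implicit Defensive.
Import GRing.Theory.
Local Open Scope ring_scope.

(** The heart of the matter is one p-th power in characteristic p.  If
    [a * x * a^-1 = x + (a - 1)] and [z] commutes with [a] and [x], then
      [(z * a + x) ^+ p = z ^+ p * a ^+ p + z * (a - a ^+ p) + x ^+ p]
    ([skew_add_exp]).  Both sides are polynomials in [z], and their difference
    has degree less than p; at the p points [z = n] of the prime field it
    vanishes because [n * a + x] is, up to the central [n], the conjugate of
    [x] by [a ^+ n].

    Existence.  The algebra is realized by matrices acting on the right on the
    space with basis the monomials x^i g; the formula, with [z] a scalar, gives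
    the relation for x^p ([model_rel]), and the action on the vector 1 shows
    that the monomials g x^i are independent ([model_free]).  An algebra with
    these relations and this basis is universal for the relations ([HE_hom]), so
    each structure map comes from checking the relations in its target.  For the
    comultiplication this is the formula with [z = x (x) 1] and [a], [x] replaced
    by [1 (x) a], [1 (x) x] ([HE_comul_rel]).  For the antipode the target is the
    endomorphism algebra of H, so as to obtain an antimorphism
    ([HE_antipode_rel]).  The Hopf axioms then only have to be verified on the
    generators ([HE_hopf_ex]).

    Structure.  The degree in x is a coalgebra filtration, and
    [(x (x) a + 1 (x) x) ^+ n] is a sum of terms [x ^+ i (x) r_i] where
    [r_n = a ^+ n] and [r_(n-1) = n a^(n-1) x] up to kG ([right_coef_diag],
    [right_coef_sub]).  Applying to the left tensor factor the coefficient
    functional of a monomial [g x^n] of top degree, one finds a group element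
    in every nonzero subcoalgebra; hence the simple subcoalgebras are the
    lines through group elements, and the coradical is kG ([HE_coradical]).
    Doing the same in degree n - 1 and using that [n] is invertible for
    [0 < n < p], one sees that H_1 is spanned by the [g] and the [g x]
    ([HE_coradical1]).  The quotient of H_1 by the action of kG then has a
    basis made of the classes of 1 and x, so the rank is one ([HE_rank]). *)

(** * The p-th power of a skew sum *)

(** Bezout: modulo p, an integer prime to p has an inverse. *)
Lemma pchar_natr_unit (R : unitRingType) (p n : nat) :
  p \in [pchar R] -> coprime p n -> n%:R \is a @GRing.unit R.
Proof.
move=> hp cpn; have [u v e _] := egcdnP n (prime_gt0 (pcharf_prime hp)).
apply/unitrP; exists (- v%:R).
have e1 : (v%:R : R) * n%:R = -1.
  move/(congr1 (fun m => m%:R : R)): e.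
  rewrite (eqP cpn) natrD !natrM (pcharf0 hp) mulr0 => /esym/eqP.
  by rewrite addr_eq0 => /eqP.
have e2 : n%:R * (v%:R : R) = -1 by rewrite -e1 -!natrM mulnC.
by rewrite mulNr mulrN e1 e2 opprK.
Qed.

(** The p elements of the prime field are central with invertible
    differences, so even over a noncommutative ring they are too many roots for
    a nonzero polynomial of degree less than p. *)
Lemma poly_pchar_eq0 (R : unitRingType) (p : nat) (P : {poly R}) :
  p \in [pchar R] -> (size P <= p)%N ->
  (forall n, P.[n%:R] = 0) -> P = 0.
Proof.
move=> hp sP rP; apply/eqP; apply/negPn/negP => nzP.
pose rs : seq R := [seq n%:R | n <- iota 0 p].
suff: (size rs < size P)%N by rewrite size_map size_iota ltnNge sP.
apply: max_ring_poly_roots => //.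
  by apply/allP => _ /mapP[n _ ->]; rewrite /root rP.
have : sorted ltn (iota 0 p) by exact: iota_ltn_sorted.
have : all (fun n => n < p)%N (iota 0 p).
  by apply/allP => n; rewrite mem_iota.
rewrite /rs; elim: (iota 0 p) => //= n s IH /andP[np sp] pns.
rewrite IH ?(path_sorted pns) // andbT all_map; apply/allP => m ms /=.
rewrite /diff_roots -!natrM mulnC eqxx /=.
have nm : (n < m)%N by apply: (allP (order_path_min ltn_trans pns)).
rewrite -natrB 1?ltnW //; apply: (pchar_natr_unit hp).
rewrite prime_coprime; last exact: pcharf_prime hp.
rewrite gtnNdvd ?subn_gt0 //.
by rewrite (leq_ltn_trans (leq_subr _ _)) //; apply: (allP sp).
Qed.

(** The coefficients need not commute, but only the product of the
    leading terms has degree n. *)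
Lemma size_linear_exp_sub (R : nzRingType) (a x : R) n :
  (size ((a *: 'X + x%:P) ^+ n - a ^+ n *: 'X^n)%R <= n)%N.
Proof.
elim: n => [|n IH]; first by rewrite !expr0 scale1r subrr size_poly0.
pose l : {poly R} := a *: 'X + x%:P.
have -> : l ^+ n.+1 - a ^+ n.+1 *: 'X^(n.+1) =
    l * (l ^+ n - a ^+ n *: 'X^n) + (x * a ^+ n) *: 'X^n.
  rewrite mulrBr -exprS -addrA; congr (_ + _).
  rewrite /l mulrDl opprD -!mul_polyC polyCM !mulrA subrK.
  rewrite exprS polyCM exprS !mulrA -[_ * 'X * (a ^+ n)%:P]mulrA.
  by rewrite -(commr_polyX (a ^+ n)%:P) mulrA.
rewrite (leq_trans (size_polyD _ _)) // geq_max; apply/andP; split.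
  have sl : (size l <= 2)%N.
    rewrite (leq_trans (size_polyD _ _)) // geq_max size_polyC.
    by rewrite (leq_trans (size_scale_leq _ _)) ?size_polyX //; case: (_ != _).
  rewrite (leq_trans (size_polyMleq _ _)) //.
  by rewrite -subn1 leq_subLR (leq_trans (leq_add sl IH)) ?add2n ?add1n.
by rewrite (leq_trans (size_scale_leq _ _)) // size_polyXn.
Qed.

Lemma skew_conj_natr (R : pzRingType) (a x : R) n :
  a * x = (x + (a - 1)) * a -> a ^+ n * x = (x + n%:R * (a - 1)) * a ^+ n.
Proof.
move=> ax; elim: n => [|n IH]; first by rewrite !expr0 mul0r addr0 mulr1 mul1r.
rewrite exprS -mulrA IH mulrA mulrDr ax mulrA (commr_nat a n) -mulrA.
have -> : a * (a - 1) = (a - 1) * a by rewrite mulrBr mulrBl mulr1 mul1r.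
rewrite mulrA -mulrDl -mulrA; congr (_ * _).
by rewrite -addrA -{1}[a - 1]mul1r -mulrDl nat1r.
Qed.

Section SkewPower.
Variables (R : unitRingType) (p : nat).
Hypothesis hp : p \in [pchar R].
Variables (a x : R).
Hypothesis ua : a \is a GRing.unit.
Hypothesis ax : a * x = (x + (a - 1)) * a.

(** In terms of [w = 1 - a^-1] the relation reads [x * w = w * (x - 1)],
    and [(x - 1) ^+ p = x ^+ p - 1]: so [x ^+ p] satisfies the same relation. *)
Lemma skew_conj_exp : a * x ^+ p = (x ^+ p + (a - 1)) * a.
Proof.
set b := a^-1.
have xb : x * b = b * x + 1 - b.
  apply: (mulrI ua); rewrite mulrA ax mulrK // !(mulrDr, mulrN) mulrA /b mulrV //.
  by rewrite mul1r mulr1 addrA.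
have xw : x * (1 - b) = (1 - b) * (x - 1).
  rewrite mulrBr mulr1 xb mulrBl mul1r mulrBr mulr1 !opprD !opprK !addrA.
  by rewrite [x - 1 - _]addrAC.
have xpw : x ^+ p * (1 - b) = (1 - b) * (x ^+ p - 1).
  have xnw n : x ^+ n * (1 - b) = (1 - b) * (x - 1) ^+ n.
    elim: n => [|n IH]; first by rewrite !expr0 mul1r mulr1.
    by rewrite exprSr -mulrA xw mulrA IH -mulrA -exprSr.
  rewrite xnw -(pFrobenius_autE hp) pFrobenius_autB_comm ?pFrobenius_aut1 //.
  exact: commr1.
have xpb : x ^+ p * b = b * x ^+ p + 1 - b.
  rewrite -[LHS](subKr (x ^+ p)) -[X in X - _ * b]mulr1 -mulrBr xpw.
  rewrite mulrBl mul1r mulrBr mulr1 opprB [LHS]addrC opprB -addrA subrK.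
  by rewrite addrAC.
have xa : x ^+ p = (b * x ^+ p + 1 - b) * a by rewrite -xpb -mulrA mulVr ?mulr1.
rewrite {1}xa mulrA mulrBr mulrDr mulrA mulrV // mul1r mulr1.
by rewrite addrA.
Qed.

(** Degree less than p in [z] against p roots: at [z = n] the left-hand
    side is the p-th power of [n + a ^+ n * x * a ^- n]. *)
Lemma skew_add_exp z : GRing.comm z a -> GRing.comm z x ->
  (z * a + x) ^+ p = z ^+ p * a ^+ p + z * (a - a ^+ p) + x ^+ p.
Proof.
move=> cza czx.
pose P : {poly R} := (a *: 'X + x%:P) ^+ p
   - (a ^+ p *: 'X^p + (a - a ^+ p) *: 'X + (x ^+ p)%:P).
have PE y : GRing.comm y a -> GRing.comm y x ->
    P.[y] = (y * a + x) ^+ p - (y ^+ p * a ^+ p + y * (a - a ^+ p) + x ^+ p).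
  move=> ya yx.
  have cay : comm_poly (a *: 'X + x%:P) y.
    by rewrite /comm_poly !hornerE mulrDr mulrDl mulrA ya yx.
  rewrite /P !hornerE horner_exp_comm // !hornerE hornerXn.
  have -> : a * y = y * a by [].
  have -> : a ^+ p * y ^+ p = y ^+ p * a ^+ p.
    by apply/commr_sym/commrX/commr_sym/commrX.
  have -> : (a - a ^+ p) * y = y * (a - a ^+ p).
    by apply/commr_sym/commrB => //; apply: commrX.
  by [].
suff P0 : P = 0.
  by apply/eqP; rewrite -subr_eq0 -PE // P0 horner0.
apply: (poly_pchar_eq0 hp) => [|n].
  rewrite /P !opprD !addrA.
  have p1 := prime_gt1 (pcharf_prime hp).
  apply: leq_trans (size_polyD _ _) _; rewrite geq_max; apply/andP; split.
    apply: leq_trans (size_polyD _ _) _; rewrite geq_max; apply/andP; split.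
      exact: size_linear_exp_sub.
    by rewrite size_polyN (leq_trans (size_scale_leq _ _)) ?size_polyX.
  by rewrite size_polyN (leq_trans (size_polyC_leq1 _)) // ltnW.
have cn y : GRing.comm n%:R y by apply/commr_sym/commr_nat.
rewrite PE //.
have -> : n%:R * a + x = n%:R + (x + n%:R * (a - 1)).
  by rewrite mulrBr mulr1 [RHS]addrC -addrA subrK addrC.
have np : n%:R ^+ p = n%:R :> R by rewrite -(pFrobenius_autE hp) pFrobenius_aut_nat.
have cc : GRing.comm n%:R (x + n%:R * (a - 1)) by apply: cn.
rewrite -(pFrobenius_autE hp) pFrobenius_autD_comm // !pFrobenius_autE np.
have -> : (x + n%:R * (a - 1)) ^+ p = x ^+ p + n%:R * (a - 1).
  have una : a ^+ n \is a GRing.unit by rewrite unitrX.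
  apply: (mulIr una).
  have axn m : (x + n%:R * (a - 1)) ^+ m * a ^+ n = a ^+ n * x ^+ m.
    elim: m => [|m IH]; first by rewrite !expr0 mul1r mulr1.
    by rewrite exprSr -mulrA -skew_conj_natr // mulrA IH -mulrA -exprSr.
  by rewrite axn skew_conj_natr //; apply: skew_conj_exp.
apply/eqP; rewrite subr_eq0 -mulrDr [a ^+ p + _]addrC subrK addrCA.
by rewrite mulrBr mulr1 [n%:R + _]addrC subrK addrC.
Qed.
End SkewPower.

(** * The tensor product of two finite-dimensional algebras *)

Section TensorFalgebra.
Variables (k : fieldType) (A B : falgType k).

Lemma tens_neq0 (U V : vectType k) (u : U) (v : V) :
  u != 0 -> v != 0 -> tens u v != 0.
Proof.
have nzc (W : vectType k) (w : W) : w != 0 -> exists i, coord (vbasis fullv) i w != 0.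
  move=> nz; apply/existsP; apply: contraNT nz; rewrite negb_exists => /forallP z.
  apply/eqP; rewrite (coord_vbasis (memvf w)) big1 // => i _.
  by move/negPn/eqP: (z i) ->; rewrite scale0r.
move=> /nzc[i ui] /nzc[j vj]; apply/eqP => /matrixP/(_ i j)/eqP.
by rewrite !mxE mulf_eq0 (negPf ui) (negPf vj).
Qed.

Fact tensor_one_neq0 : (1 : tensor A B) != 0.
Proof. by apply: tens_neq0; apply: oner_neq0. Qed.

HB.instance Definition _ :=
  GRing.PzSemiRing_isNonZero.Build (tensor A B) tensor_one_neq0.

Fact tensor_scalerAl (q : k) (s t : tensor A B) : q *: (s * t) = (q *: s) * t.
Proof.
have e : (q *: s + 0) * t = q *: (s * t) + 0 * t := tmul_linear_l t q s 0.
by move: e; rewrite mul0r !addr0.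
Qed.

Fact tensor_scalerAr (q : k) (s t : tensor A B) : q *: (s * t) = s * (q *: t).
Proof.
have e : s * (q *: t + 0) = q *: (s * t) + s * 0 := tmul_linear_r s q t 0.
by move: e; rewrite mulr0 !addr0.
Qed.

HB.instance Definition _ :=
  GRing.LSemiModule_isLSemiAlgebra.Build k (tensor A B) tensor_scalerAl.
HB.instance Definition _ :=
  GRing.LSemiAlgebra_isSemiAlgebra.Build k (tensor A B) tensor_scalerAr.
HB.instance Definition _ := Algebra_isFalgebra.Build k (tensor A B).

(** Multiplicativity is a bilinear condition, so that pure tensors
    suffice. *)
Lemma tensor_mulE (C : falgType k) (f : 'Hom(tensor A B, C)) :
  (forall a b a' b', f (tens (a * a') (b * b')) = f (tens a b) * f (tens a' b')) ->
  forall s t, f (s * t) = f s * f t.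
Proof.
move=> fM s t; elim/tensor_ind: s => [q s s' Hs Hs'|a b].
  by rewrite mulrDl -scalerAl !linearP /= Hs Hs' mulrDl -scalerAl.
elim/tensor_ind: t => [q t t' Ht Ht'|a' b'].
  by rewrite mulrDr -scalerAr !linearP /= Ht Ht' mulrDr -scalerAr.
by rewrite tens_mul fM.
Qed.

End TensorFalgebra.

Section TensLin.
Variables (k : fieldType) (U V : vectType k).
Lemma tensDl (u u' : U) (v : V) : tens (u + u') v = tens u v + tens u' v.
Proof. by have := tens_is_linear_l v 1 u u'; rewrite /= !scale1r. Qed.
Lemma tensDr (u : U) (v v' : V) : tens u (v + v') = tens u v + tens u v'.
Proof. by have := tens_is_linear_r u 1 v v'; rewrite /= !scale1r. Qed.
Lemma tens0l (v : V) : tens (0 : U) v = 0.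
Proof. by apply/(addrI (tens 0 v)); rewrite -tensDl !addr0. Qed.
Lemma tens0r (u : U) : tens u (0 : V) = 0.
Proof. by apply/(addrI (tens u 0)); rewrite -tensDr !addr0. Qed.
Lemma tensZl q (u : U) (v : V) : tens (q *: u) v = q *: tens u v.
Proof. by have := tens_is_linear_l v q u 0; rewrite /= tens0l !addr0. Qed.
Lemma tensZr q (u : U) (v : V) : tens u (q *: v) = q *: tens u v.
Proof. by have := tens_is_linear_r u q v 0; rewrite /= tens0r !addr0. Qed.
Lemma tensNl (u : U) (v : V) : tens (- u) v = - tens u v.
Proof. by rewrite -scaleN1r tensZl scaleN1r. Qed.
Lemma tensNr (u : U) (v : V) : tens u (- v) = - tens u v.
Proof. by rewrite -scaleN1r tensZr scaleN1r. Qed.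
End TensLin.

Lemma tens_exp (k : fieldType) (A B : falgType k) (u : A) (v : B) n :
  tens u v ^+ n = tens (u ^+ n) (v ^+ n).
Proof. by elim: n => [|n IH]; rewrite ?expr0 // !exprS IH tens_mul. Qed.

Lemma tmapE (k : fieldType) (U V U' V' : vectType k) (f : 'Hom(U, U'))
  (g : 'Hom(V, V')) u v : tmap f g (tens u v) = tens (f u) (g v).
Proof.
by apply: tliftE => [y|y] q z z'; rewrite linearP ?tensDl ?tensDr ?tensZl ?tensZr.
Qed.

Lemma tassocE (k : fieldType) (U V W : vectType k) (u : U) (v : V) (w : W) :
  tassoc U V W (tens (tens u v) w) = tens u (tens v w).
Proof.
have in1 w' u' v' : tlift (fun u v => tens u (tens v w')) (tens u' v')
   = tens u' (tens v' w').
  by apply: tliftE => [y|y] q z z';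
     rewrite ?tensDl ?tensDr ?tensZl ?tensZr ?tensDl ?tensDr ?tensZl ?tensZr.
rewrite /tassoc tliftE ?in1 // => [y|y] q z z'; first by rewrite linearP.
rewrite !lfunE /= /tlift_fun scaler_sumr -big_split; apply: eq_bigr => i _ /=.
rewrite scaler_sumr -big_split; apply: eq_bigr => j _ /=.
by rewrite tensDr tensZr tensDr tensZr scalerDr !scalerA mulrC.
Qed.

Lemma tmap_mul (k : fieldType) (A B C D : falgType k) (f : 'Hom(A, C)) (g : 'Hom(B, D)) :
  {morph f : u v / u * v} -> {morph g : u v / u * v} ->
  {morph tmap f g : s t / s * t}.
Proof.
by move=> fM gM; apply: tensor_mulE => u v u' v'; rewrite !tmapE tens_mul fM gM.
Qed.

Lemma tassoc_mul (k : fieldType) (A B C : falgType k) :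
  {morph tassoc A B C : s t / s * t}.
Proof.
apply: tensor_mulE => t w t' w'.
elim/tensor_ind: t => [q s s' Hs Hs'|u v].
  rewrite mulrDl -scalerAl !tensDl !tensZl !linearP /= Hs Hs'.
  by rewrite mulrDl -scalerAl.
elim/tensor_ind: t' => [q s s' Hs Hs'|u' v'].
  rewrite mulrDr -scalerAr !tensDl !tensZl !linearP /= Hs Hs'.
  by rewrite mulrDr -scalerAr.
by rewrite tens_mul !tassocE !tens_mul.
Qed.

(** * Algebras with the relations of H_E *)

Lemma basis_lfun_ext (k : fieldType) (V W : vectType k) (T : eqType) (s : seq T)
    (e : T -> V) (F : T -> W) :
  basis_of fullv (map e s) -> exists f : 'Hom(V, W), {in s, forall t, f (e t) = F t}.
Proof.
move=> bs; have [f] := linear_of_free (map e s) (map F s).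
rewrite !size_map -map_comp => /(_ (basis_free bs) erefl)/eq_in_map ef.
by exists (linfun f) => t ts; rewrite lfunE /= -[RHS](ef t ts).
Qed.

Lemma basis_lfun_eq (k : fieldType) (V W : vectType k) (X : seq V) (f f' : 'Hom(V, W)) :
  basis_of fullv X -> {in X, f =1 f'} -> f = f'.
Proof.
move=> bX ff; apply/lfunP => v.
have /coord_span -> : v \in <<in_tuple X>>%VS by rewrite (span_basis bX) memvf.
rewrite !linear_sum; apply: eq_bigr => i _; rewrite !linearZ /=.
by rewrite ff // mem_nth.
Qed.

Section HERel.
Variables (k : fieldType) (p : nat) (hp : p \in [pchar k]).
Variables (G : finGroupType) (a : G) (c : G -> k) (alpha : k).
Hypothesis hE : third_datum p a c.

(** The defining relations of H_E for a family and an element of an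
    arbitrary algebra: such data are what a morphism from H_E amounts to. *)
Definition HE_rel (B : falgType k) (phi : G -> B) (y : B) : Prop :=
  [/\ phi 1%g = 1, {morph phi : g h / (g * h)%g >-> g * h},
      forall g, phi g * y * phi g^-1%g = y + c g *: (phi a - 1) &
      y ^+ p = y + alpha *: (phi (a ^+ p)%g - 1)].

Definition HE_seq (B : falgType k) (phi : G -> B) (y : B) : seq B :=
  [seq phi g * y ^+ i | g <- enum G, i <- index_iota 0 p].

Let p_gt1 : (1 < p)%N := prime_gt1 (pcharf_prime hp).

Lemma datum_commute g : (a * g = g * a)%g.
Proof. by case: hE => /centerP[_ /(_ g)] -> //; rewrite inE. Qed.

Lemma datum1 : c 1%g = 0.
Proof. by case: hE => _ _ cM _ _; apply/(addrI (c 1%g)); rewrite -cM mulg1 addr0. Qed.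

Lemma datumV g : c g^-1%g = - c g.
Proof.
case: hE => _ _ cM _ _; apply/(addrI (c g)).
by rewrite -cM mulgV datum1 subrr.
Qed.

Section Rel.
Variables (B : falgType k) (phi : G -> B) (y : B).
Hypothesis hr : HE_rel phi y.

Lemma HE_phiV g : phi g * phi g^-1%g = 1.
Proof. by case: hr => p1 pM _ _; rewrite -pM mulgV. Qed.

Lemma HE_phiVg g : phi g^-1%g * phi g = 1.
Proof. by case: hr => p1 pM _ _; rewrite -pM mulVg. Qed.

Lemma HE_unit g : phi g \is a GRing.unit.
Proof. by apply/unitrP; exists (phi g^-1%g); rewrite HE_phiV HE_phiVg. Qed.

Lemma HE_inv g : (phi g)^-1 = phi g^-1%g.
Proof. by apply: (mulrI (HE_unit g)); rewrite mulrV ?HE_unit // HE_phiV. Qed.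

Lemma HE_phiX g n : phi (g ^+ n)%g = phi g ^+ n.
Proof.
case: hr => p1 pM _ _; elim: n => [|n IH]; first by rewrite expg0 expr0.
by rewrite expgS pM IH exprS.
Qed.

(** The commutation rule that brings every product of generators into the
    span of the monomials [phi g * y ^+ i]. *)
Lemma HE_move g : y * phi g = phi g * y - c g *: (phi (g * a)%g - phi g).
Proof.
case: hr => p1 pM pJ _; have := pJ g^-1%g.
rewrite invgK datumV => /(congr1 (fun z => phi g * z)).
rewrite !mulrA HE_phiV mul1r => ->.
by rewrite mulrDr -scalerAr scaleNr mulrBr mulr1 -pM.
Qed.

Lemma HE_skew : phi a * y = (y + (phi a - 1)) * phi a.
Proof.
case: hr => p1 pM pJ _; case: hE => _ _ _ ca _; have := pJ a.
by rewrite ca scale1r => <-; rewrite -mulrA HE_phiVg mulr1.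
Qed.

Lemma HE_top g : phi g * y ^+ p = phi g * y + alpha *: (phi (g * a ^+ p)%g - phi g).
Proof. by case: hr => p1 pM _ ->; rewrite mulrDr -scalerAr mulrBr mulr1 -pM. Qed.
End Rel.

Section Basis.
Variables (B : falgType k) (phi : G -> B) (y : B).
Hypothesis hb : basis_of fullv (HE_seq phi y).

(** Linear maps on an algebra with the monomial basis are given freely by
    their values on the monomials. *)
Lemma HE_ext (W : vectType k) (F : G -> nat -> W) :
  exists f : 'Hom(B, W), forall g i, (i < p)%N -> f (phi g * y ^+ i) = F g i.
Proof.
pose s : seq (G * nat) := [seq (g, i) | g <- enum G, i <- index_iota 0 p].
have [|f ef] := @basis_lfun_ext k B W _ s (fun t => phi t.1 * y ^+ t.2) (fun t => F t.1 t.2).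
  by rewrite /s map_allpairs.
exists f => g i ip; apply: (ef (g, i)).
by apply: allpairs_f; rewrite ?mem_enum // mem_index_iota.
Qed.

Lemma HE_eq (W : vectType k) (f f' : 'Hom(B, W)) :
  (forall g i, (i < p)%N -> f (phi g * y ^+ i) = f' (phi g * y ^+ i)) -> f = f'.
Proof.
move=> ff; apply: (basis_lfun_eq hb) => _ /allpairsP[[g i] /= [_ + ->]].
by rewrite mem_index_iota => /ff.
Qed.

Lemma HE_ind (P : B -> Prop) :
  (forall q u v, P u -> P v -> P (q *: u + v)) ->
  (forall g i, (i < p)%N -> P (phi g * y ^+ i)) -> forall v, P v.
Proof.
move=> Plin PX v.
have PXn u : u \in HE_seq phi y -> P u.
  by move=> /allpairsP[[g i] /= [_ + ->]]; rewrite mem_index_iota; apply: PX.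
have P0 : P 0.
  have := PX 1%g 0 (ltnW p_gt1); set u := _ * _ => Pu.
  by have := Plin (-1) _ _ Pu Pu; rewrite scaleN1r addNr.
have /coord_span -> : v \in <<in_tuple (HE_seq phi y)>>%VS.
  by rewrite (span_basis hb) memvf.
apply: big_ind => // [u w Pu Pw|i _]; first by rewrite -[u]scale1r; apply: Plin.
by rewrite -[X in P X]addr0; apply: Plin => //; apply: PXn; apply: mem_nth.
Qed.

Hypothesis hr : HE_rel phi y.

(** The universal property.  The linear map sending monomials to monomials
    commutes with left multiplication by the generators, because the rewriting
    rules [HE_move] and [HE_top] hold in source and target alike; it is thus
    multiplicative. *)
Lemma HE_hom (C : falgType k) (psi : G -> C) (z : C) : HE_rel psi z ->
  exists f : 'Hom(B, C), [/\ f 1 = 1, {morph f : u v / u * v},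
    forall g, f (phi g) = psi g & f y = z].
Proof.
move=> hs; have [f fE] := HE_ext (fun g i => psi g * z ^+ i).
have f0 g : f (phi g) = psi g.
  by have := fE g 0; rewrite !expr0 !mulr1 => -> //; apply: ltnW.
have [p1 pM pJ _] := hr; have [s1 sM sJ _] := hs.
have f1 : f 1 = 1 by rewrite -p1 f0.
have fy : f y = z by have := fE 1%g 1; rewrite p1 s1 !mul1r; apply.
have fS g i : (i <= p)%N -> f (phi g * y ^+ i) = psi g * z ^+ i.
  rewrite leq_eqVlt => /predU1P[->|]; last exact: fE.
  rewrite (HE_top hr) (HE_top hs) linearD linearZ linearB /= !f0.
  by have /= := fE g 1; rewrite !expr1 => ->.
have fg g v : f (phi g * v) = psi g * f v.
  suff /lfunP/(_ v) : (f \o amull (phi g))%VF = (amull (psi g) \o f)%VF.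
    by rewrite !comp_lfunE !lfunE.
  apply: HE_eq => h i ip; rewrite !comp_lfunE !lfunE /= mulrA -pM !fE //.
  by rewrite sM mulrA.
have fyv v : f (y * v) = z * f v.
  suff /lfunP/(_ v) : (f \o amull y)%VF = (amull z \o f)%VF.
    by rewrite !comp_lfunE !lfunE.
  apply: HE_eq => h i ip; rewrite !comp_lfunE !lfunE /= mulrA fE // mulrA.
  rewrite (HE_move hr) (HE_move hs) !mulrBl -!scalerAl !mulrBl -!mulrA -!exprS.
  by rewrite linearB linearZ linearB /= !fS // ltnW.
have fyn n v : f (y ^+ n * v) = z ^+ n * f v.
  by elim: n v => [|n IH] v; rewrite ?expr0 ?mul1r // !exprSr -!mulrA IH fyv.
exists f; split=> // u v.
suff /lfunP/(_ u) : (f \o amulr v)%VF = (amulr (f v) \o f)%VF.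
  by rewrite !comp_lfunE !lfunE.
apply: HE_eq => h i ip; rewrite !comp_lfunE !lfunE /=.
by rewrite -mulrA fg fyn fE // mulrA.
Qed.

Lemma HE_hom_eq (C : falgType k) (f f' : 'Hom(B, C)) :
  f 1 = 1 -> f' 1 = 1 -> {morph f : u v / u * v} -> {morph f' : u v / u * v} ->
  (forall g, f (phi g) = f' (phi g)) -> f y = f' y -> f = f'.
Proof.
move=> f1 f1' fM fM' fg fy; apply: HE_eq => g i _; rewrite fM fM' fg; congr (_ * _).
by elim: i => [|i IH]; rewrite ?expr0 ?f1 // !exprS fM fM' fy IH.
Qed.
End Basis.
End HERel.

(** * The Hopf structure *)

Section HopfStructure.
Variables (k : fieldType) (p : nat) (hp : p \in [pchar k]).
Variables (G : finGroupType) (a : G) (c : G -> k) (alpha : k).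
Hypothesis hE : third_datum p a c.
Variables (H : falgType k) (inc : G -> H) (x : H).
Hypothesis hr : HE_rel p a c alpha inc x.
Hypothesis hb : basis_of fullv (HE_seq p inc x).

Let inc1 : inc 1%g = 1. Proof. by case: hr. Qed.
Let incM : {morph inc : g h / (g * h)%g >-> g * h}. Proof. by case: hr. Qed.
Let incJ g : inc g * x * inc g^-1%g = x + c g *: (inc a - 1).
Proof. by case: hr. Qed.
Let xp : x ^+ p = x + alpha *: (inc (a ^+ p)%g - 1). Proof. by case: hr. Qed.
Let pA (A : falgType k) : p \in [pchar A]. Proof. by rewrite pchar_lalg. Qed.

Definition diag_inc g : tensor H H := tens (inc g) (inc g).
Definition comul_x : tensor H H := tens x (inc a) + tens 1 x.

(** The p-th power of [x (x) a + 1 (x) x] is [skew_add_exp] for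
    [z = x (x) 1]: the terms [x (x) a ^+ p] and [alpha *: (1 (x) a ^+ p)] that
    it produces cancel. *)
Lemma HE_comul_rel : HE_rel p a c alpha diag_inc comul_x.
Proof.
split.
- by rewrite /diag_inc inc1.
- by move=> g h; rewrite /diag_inc incM tens_mul.
- move=> g; rewrite /diag_inc /comul_x mulrDr mulrDl !tens_mul mulr1 (HE_phiV hr) incJ.
  have -> : inc g * inc a * inc g^-1%g = inc a.
    by rewrite -incM -(datum_commute hE) incM -mulrA (HE_phiV hr) mulr1.
  rewrite tensDl tensDr addrACA; congr (_ + _).
  rewrite tensZl tensZr -scalerDr; congr (_ *: _).
  by rewrite tensDl tensDr tensNl tensNr addrA subrK.
- pose A : tensor H H := tens 1 (inc a).
  pose X : tensor H H := tens 1 x.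
  pose Z : tensor H H := tens x 1.
  have uA : A \is a GRing.unit.
    apply/unitrP; exists (tens 1 (inc a^-1%g)).
    by rewrite !tens_mul (HE_phiV hr) (HE_phiVg hr) mulr1.
  have AX : A * X = (X + (A - 1)) * A.
    rewrite tens_mul (HE_skew hE hr) mulr1 /A /X.
    have -> : (1 : tensor H H) = tens 1 1 by [].
    by rewrite -tensNr -!tensDr tens_mul mulr1.
  have ZA : GRing.comm Z A by rewrite /GRing.comm !tens_mul !mulr1 !mul1r.
  have ZX : GRing.comm Z X by rewrite /GRing.comm !tens_mul !mulr1 !mul1r.
  have := skew_add_exp (pA (tensor H H)) uA AX ZA ZX.
  rewrite /comul_x tens_mul mul1r mulr1 -/X => ->.
  rewrite /Z /A /X /diag_inc !tens_exp !expr1n tens_mul mul1r mulr1.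
  rewrite -tensNr -tensDr tens_mul mul1r mulr1 xp.
  have aE : inc (a ^+ p)%g = inc a ^+ p by rewrite (HE_phiX hr).
  rewrite aE; set ap := inc a ^+ p.
  rewrite [tens (x + _) ap]tensDl tensZl [tens (ap - 1) ap]tensDl tensNl.
  rewrite [tens x (inc a - ap)]tensDr [tens x (- ap)]tensNr.
  rewrite [tens 1 (x + _)]tensDr tensZr [tens 1 (ap - 1)]tensDr [tens 1 (- 1)]tensNr.
  have cancel (V : zmodType) (t q t' s q' : V) :
      t + q + (t' - t) + (s + q') = t' + s + (q + q').
    by rewrite [t + q]addrC -[q + t + _]addrA [t + _]addrC subrK [q + t']addrC addrACA.
  rewrite cancel -scalerDr; congr (_ + _ *: _).
  by rewrite addrA subrK.
Qed.

Lemma HE_counit_rel : HE_rel p a c alpha (fun=> 1 : k^o) 0.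
Proof.
split=> // [g h|g|]; first by rewrite mulr1.
  by rewrite mulr0 mul0r subrr scaler0 addr0.
by rewrite expr0n subrr scaler0 addr0 eqn0Ngt (prime_gt0 (pcharf_prime hp)).
Qed.

Import FalgLfun.

(** The product of the algebra of endomorphisms is [f * g = g \o f], so
    left multiplications reverse products and a morphism into them is an
    antimorphism of H.  For the p-th power of [s = - (x * a^-1)], the operator
    [v |-> s * v * a + v * x] kills 1, hence so does its p-th power; expanding
    the latter by [skew_add_exp], with [z] the left multiplication by [s] and
    [a], [x] replaced by right multiplications, gives the value of [s ^+ p]. *)
Lemma HE_antipode_rel : HE_rel p a c alpha
  (fun g => amull (inc g^-1%g)) (amull (- (x * inc a^-1%g))).
Proof.
set b := inc a^-1%g; set s := - (x * b).
have ba : b * inc a = 1 by apply: (HE_phiVg hr).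
have ab : inc a * b = 1 by apply: (HE_phiV hr).
have am1 : (1 : 'End(H)) = amull 1 by rewrite amull1.
split.
- by rewrite invg1 inc1 amull1.
- by move=> g h; rewrite invMg incM amullM.
- move=> g; rewrite invgK -!amullM am1 -linearB -linearZ -linearD /=.
  congr amull; rewrite mulrA /s mulrN mulNr.
  have -> : inc g * (x * b) * inc g^-1%g = inc g * x * inc g^-1%g * b.
    rewrite -!mulrA; do 2 congr (_ * _).
    rewrite -!incM; congr inc.
    by apply: (mulgI a); rewrite !mulgA mulgV mul1g (datum_commute hE) -mulgA mulgV mulg1.
  rewrite incJ mulrDl -scalerAl mulrBl mul1r ab opprD -scalerN.
  by rewrite opprB.
have uA : amulr (inc a) \is a GRing.unit.
  by apply/unitrP; exists (amulr b); rewrite -!rmorphM /= ab ba rmorph1.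
have AX : amulr (inc a) * amulr x = (amulr x + (amulr (inc a) - 1)) * amulr (inc a).
  have -> : (1 : 'End(H)) = amulr 1 by rewrite rmorph1.
  by rewrite -rmorphB -rmorphD -!rmorphM /= (HE_skew hE hr).
have ZC u : GRing.comm (amull s) (amulr u).
  by apply/lfunP => v; rewrite !lfun_mulE !lfunE /= mulrA.
have amullX u n : amull (u ^+ n) = amull u ^+ n.
  elim: n => [|n IH]; first by rewrite !expr0 amull1.
  by rewrite exprSr amullM IH -exprS.
have /lfunP/(_ 1) := skew_add_exp (pA 'End(H)) uA AX (ZC _) (ZC _).
rewrite -!amullX -!rmorphXn -rmorphB !add_lfunE !lfun_mulE.
set f := amull s * amulr (inc a) + amulr x.
have f1 : f 1 = 0.
  rewrite add_lfunE lfun_mulE !lfunE /= mul1r mulr1 /s mulNr -mulrA ba mulr1.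
  by rewrite addNr.
rewrite -[p in _ ^+ p](prednK (prime_gt0 (pcharf_prime hp))) exprS lfun_mulE f1 linear0.
rewrite !lfunE /= !mulr1 mul1r mulrBr.
have -> : s * inc a = - x by rewrite /s mulNr -mulrA ba mulr1.
have cancel (V : zmodType) (t u q y : V) : 0 = t + (- y - u) + (y + q) -> t = u - q.
  rewrite -addrA addrACA addNr add0r => /esym/eqP.
  by rewrite addr_eq0 opprD opprK => /eqP.
rewrite xp => /cancel spE.
rewrite am1 -linearB -linearZ -linearD /=; congr amull.
apply: (mulIr (unitrX p (HE_unit hr a))).
rewrite mulrDl -scalerAl mulrBl mul1r -(HE_phiX hr) -incM mulVg inc1 (HE_phiX hr).
by rewrite spE (HE_phiX hr) -scalerN opprB.
Qed.

(** Every element of the image of the morphism given by [HE_antipode_rel] is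
    a left multiplication, namely by the antipode of the argument. *)
Lemma HE_antipode_ex : exists S : 'End(H), [/\ S 1 = 1,
  forall u v, S (u * v) = S v * S u &
  forall g i, (i < p)%N ->
    S (inc g * x ^+ i) = (- (x * inc a^-1%g)) ^+ i * inc g^-1%g].
Proof.
pose s := - (x * inc a^-1%g).
have [S SE] := HE_ext hb (fun g i => s ^+ i * inc g^-1%g).
have [rho [rho1 rhoM rhog rhox]] := HE_hom hp hE hb hr HE_antipode_rel.
have rhoE u : rho u = amull (S u).
  suff /lfunP/(_ u) : rho = (linfun (@amull k H) \o S)%VF by rewrite comp_lfunE lfunE.
  apply: (HE_eq hb) => g i ip; rewrite comp_lfunE SE // lfunE /= rhoM rhog amullM.
  congr (_ * _); elim: i {ip} => [|i IH]; first by rewrite !expr0 rho1 amull1.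
  by rewrite exprS rhoM IH rhox exprSr amullM.
exists S; split=> // [|u v]; apply: amull_inj; first by rewrite -rhoE rho1 amull1.
by rewrite -rhoE rhoM !rhoE amullM.
Qed.

(** The two sides of coassociativity and of the counit laws are algebra
    morphisms that agree on generators.  The antipode laws are not of this
    form, but the elements at which they hold are closed under products since
    the antipode reverses products. *)
Lemma HE_hopf_ex :
  exists (K : hopfType k) (i : G -> K) (y : K), is_HE p a c alpha i y.
Proof.
have [D [D1 DM Dg Dx]] := HE_hom hp hE hb hr HE_comul_rel.
have [E [E1 EM Eg Ex]] := HE_hom hp hE hb hr HE_counit_rel.
have [S [S1 SM SE]] := HE_antipode_ex.
have p1 := prime_gt1 (pcharf_prime hp).
have Sg g : S (inc g) = inc g^-1%g.
  by have := SE g 0; rewrite !expr0 mulr1 mul1r => -> //; apply: ltnW.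
have Sx : S x = - (x * inc a^-1%g).
  by have := SE 1%g 1; rewrite invg1 inc1 mul1r mulr1 !expr1 => ->.
have Dx' : D x = tens x (inc a) + tens 1 x by [].
have idM : {morph (\1%VF : 'End(H)) : u v / u * v} by move=> u v; rewrite !id_lfunE.
have DA h : tassoc H H H (tmap D \1 (D h)) = tmap \1 D (D h).
  suff /lfunP/(_ h) : (tassoc H H H \o (tmap D \1 \o D))%VF = (tmap \1 D \o D)%VF.
    by rewrite !comp_lfunE.
  have D11 : D 1 = tens 1 1 by [].
  apply: (HE_hom_eq hb).
  - by rewrite !comp_lfunE D11 tmapE id_lfunE D11 tassocE.
  - by rewrite !comp_lfunE D11 tmapE id_lfunE D11.
  - by move=> u v; rewrite !comp_lfunE DM tmap_mul // tassoc_mul.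
  - by move=> u v; rewrite !comp_lfunE DM tmap_mul.
  - by move=> g; rewrite !comp_lfunE Dg !tmapE !id_lfunE Dg tassocE.
  - rewrite !comp_lfunE Dx' !linearD /= !tmapE !id_lfunE D11 Dx' Dg.
    by rewrite tensDl tensDr linearD /= !tassocE addrA.
have el u v : tlift (fun u v => E u *: v) (tens u v) = E u *: v.
  by apply: tliftE => [w|w] q z z'; rewrite linearP ?scalerDl ?scalerA.
have er u v : tlift (fun u v => E v *: u) (tens u v) = E v *: u.
  by apply: tliftE => [w|w] q z z'; rewrite linearP ?scalerDl ?scalerA.
have EL h : tlift (fun u v => E u *: v) (D h) = h.
  suff /lfunP/(_ h) : (tlift (fun u v => E u *: v) \o D)%VF = \1%VF.
    by rewrite comp_lfunE id_lfunE.
  apply: (HE_hom_eq hb) => //.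
  - by rewrite comp_lfunE D1 el E1 scale1r.
  - by rewrite id_lfunE.
  - move=> u v; rewrite !comp_lfunE DM tensor_mulE // => *.
    by rewrite !el EM -scalerAl -scalerAr scalerA.
  - by move=> g; rewrite comp_lfunE id_lfunE Dg el Eg scale1r.
  - by rewrite comp_lfunE id_lfunE Dx' linearD /= !el E1 Ex scale0r add0r scale1r.
have ER h : tlift (fun u v => E v *: u) (D h) = h.
  suff /lfunP/(_ h) : (tlift (fun u v => E v *: u) \o D)%VF = \1%VF.
    by rewrite comp_lfunE id_lfunE.
  apply: (HE_hom_eq hb) => //.
  - by rewrite comp_lfunE D1 er E1 scale1r.
  - by rewrite id_lfunE.
  - move=> u v; rewrite !comp_lfunE DM tensor_mulE // => *.
    by rewrite !er EM -scalerAl -scalerAr scalerA.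
  - by move=> g; rewrite comp_lfunE id_lfunE Dg er Eg scale1r.
  - by rewrite comp_lfunE id_lfunE Dx' linearD /= !er Eg Ex scale0r addr0 scale1r.
have sl u v : tlift (fun u v => S u * v) (tens u v) = S u * v.
  by apply: tliftE => [w|w] q z z';
    rewrite ?linearP /= ?mulrDl ?mulrDr -?scalerAl -?scalerAr.
have sr u v : tlift (fun u v => u * S v) (tens u v) = u * S v.
  by apply: tliftE => [w|w] q z z';
    rewrite ?linearP /= ?mulrDl ?mulrDr -?scalerAl -?scalerAr.
have slM (s t : tensor H H) e :
    tlift (fun u v => S u * v) s = e *: 1 ->
  tlift (fun u v => S u * v) (s * t) = e *: tlift (fun u v => S u * v) t.
  move=> se; elim/tensor_ind: t => [q t t' Ht Ht'|u v].
    by rewrite mulrDr -scalerAr !linearP /= Ht Ht'.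
  have -> : tlift (fun u v => S u * v) (s * tens u v) =
      S u * tlift (fun u v => S u * v) s * v.
    elim/tensor_ind: {se} s => [q s s' Hs Hs'|u' v'].
      rewrite mulrDl -scalerAl !linearP /= Hs Hs' mulrDr mulrDl.
      by rewrite -scalerAr -scalerAl.
    by rewrite tens_mul !sl SM !mulrA.
  by rewrite se sl -scalerAr mulr1 -scalerAl.
have srM (s t : tensor H H) e :
    tlift (fun u v => u * S v) t = e *: 1 ->
  tlift (fun u v => u * S v) (s * t) = e *: tlift (fun u v => u * S v) s.
  move=> te; elim/tensor_ind: s => [q s s' Hs Hs'|u v].
    by rewrite mulrDl -scalerAl !linearP /= Hs Hs'.
  have -> : tlift (fun u v => u * S v) (tens u v * t) =
      u * tlift (fun u v => u * S v) t * S v.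
    elim/tensor_ind: {te} t => [q t t' Ht Ht'|u' v'].
      rewrite mulrDr -scalerAr !linearP /= Ht Ht' mulrDr mulrDl.
      by rewrite -scalerAr -scalerAl.
    by rewrite tens_mul !sr SM !mulrA.
  by rewrite te sr -scalerAr mulr1 -scalerAl.
pose anti h := tlift (fun u v => S u * v) (D h) = E h *: 1 /\
  tlift (fun u v => u * S v) (D h) = E h *: 1.
have antiM u v : anti u -> anti v -> anti (u * v).
  move=> [lu ru] [lv rv]; split; rewrite DM EM.
    by rewrite (slM _ _ _ lu) lv scalerA.
  by rewrite (srM _ _ _ rv) ru scalerA mulrC.
have antig g : anti (inc g).
  by split; rewrite Dg Eg scale1r ?sl ?sr Sg ?(HE_phiV hr) ?(HE_phiVg hr).
have antix : anti x.
  split; rewrite Dx' Ex linearD /= ?sl ?sr ?S1 ?Sx ?Sg scale0r.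
    by rewrite mulNr -mulrA (HE_phiVg hr) mulr1 mul1r addNr.
  by rewrite mul1r subrr.
have antiA h : anti h.
  apply: (HE_ind hp hb) h => [q u v [lu ru] [lv rv]|g i _].
    by split; rewrite !linearP /= ?lu ?ru ?lv ?rv scalerDl scalerA.
  apply: (antiM) => //; elim: i => [|i IH]; last by rewrite exprS; apply: (antiM).
  by rewrite expr0 -inc1.
pose K : hopfType k := HB.pack (Falgebra.sort H)
  (isHopf.Build k H DA EL ER D1 DM E1 EM (fun h => proj1 (antiA h)) (fun h => proj2 (antiA h))).
have Dxi i : D (x ^+ i) = comul_x ^+ i.
  by elim: i => [|i IH]; rewrite ?expr0 // !exprS DM Dx IH.
exists K, inc, x; split=> //.
- by move=> g i _; rewrite -[LHS]/(D _) DM Dg Dxi.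
- move=> g i _; rewrite -[LHS]/(E _) EM Eg mul1r.
  by case: i => [|i]; rewrite ?expr0 // exprS EM Ex mul0r.
Qed.
End HopfStructure.

(** * Subalgebras spanned by monomials *)

Section Existence.
Variables (k : fieldType) (p : nat) (hp : p \in [pchar k]).
Variables (G : finGroupType) (a : G) (c : G -> k) (alpha : k).
Hypothesis hE : third_datum p a c.
Let p_gt1 : (1 < p)%N := prime_gt1 (pcharf_prime hp).

(** The scalar case of [skew_add_exp], translated by [q]; the hypothesis
    kills the defect [(q ^+ p - q) *: (u ^+ p - 1)].  With
    [q = c g] it says that conjugation by g respects the relation for x^p. *)
Lemma skew_add_scalar_exp (A : falgType k) (u x : A) (q : k) :
  u \is a GRing.unit -> u * x = (x + (u - 1)) * u ->
  (q ^+ p - q) *: (u ^+ p - 1) = 0 ->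
  (x + q *: (u - 1)) ^+ p = x ^+ p + q *: (u - 1).
Proof.
move=> uu ux qp; have hpA : p \in [pchar A] by rewrite pchar_lalg.
have cq y : GRing.comm (q%:A : A) y by rewrite /GRing.comm mulr_algl mulr_algr.
(* The shift by the scalar q turns [q *: u + (x - q)] into [x + q *: (u - 1)]. *)
have ux' : u * (x - q%:A) = (x - q%:A + (u - 1)) * u.
  by rewrite mulrBr ux addrAC [RHS]mulrBl (cq u).
have := skew_add_exp hpA uu ux' (cq u) (cq _).
rewrite -(pFrobenius_autE hpA (x - _)) pFrobenius_autB_comm; last exact/commr_sym/cq.
rewrite !pFrobenius_autE exprZn expr1n !mulr_algl.
have -> : q *: u + (x - q%:A) = x + q *: (u - 1) by rewrite scalerBr addrCA.
move=> ->; rewrite addrCA; congr (_ + _); rewrite addrAC -scalerBr.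
move: qp => /eqP; rewrite scalerBl subr_eq0 => /eqP ->.
by rewrite -scalerDr addrC addrA subrK.
Qed.

(** The span is stable under left multiplication by the generators, by
    [HE_move] and [HE_top]. *)
Lemma HE_span_mul (B : falgType k) (phi : G -> B) (y : B) :
  HE_rel p a c alpha phi y ->
  {in <<HE_seq p phi y>>%VS &, forall u v, u * v \in <<HE_seq p phi y>>%VS}.
Proof.
move=> hr; have [p1 pM pJ py] := hr; set U := (<<_>>%VS).
have sU g i : (i <= p)%N -> phi g * y ^+ i \in U.
  have lt h j : (j < p)%N -> phi h * y ^+ j \in U.
    move=> jp; apply: memv_span; apply: allpairs_f; rewrite ?mem_enum //.
    by rewrite mem_index_iota.
  rewrite leq_eqVlt => /predU1P[->|/lt//]; rewrite (HE_top hr).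
  have l0 h : phi h \in U by rewrite -[phi h]mulr1 -[1](expr0 y) lt // ltnW.
  by rewrite memvD // ?memvZ ?memvB // -[y]expr1 lt.
have Uim (f : 'End(B)) u :
    (forall g i, (i < p)%N -> f (phi g * y ^+ i) \in U) -> u \in U -> f u \in U.
  move=> fU uU; suff /subvP : (f @: U <= U)%VS by apply; apply: memv_img.
  rewrite limg_span; apply/span_subvP => _ /mapP[_ /allpairsP[[g i] /= [_ + ->]] ->].
  by rewrite mem_index_iota => /fU.
have Ug g u : u \in U -> phi g * u \in U.
  move=> uU; have := @Uim (amull (phi g)) u; rewrite lfunE /=; apply => // h i ip.
  by rewrite lfunE /= mulrA -pM sU // ltnW.
have Uy u : u \in U -> y * u \in U.
  move=> uU; have := @Uim (amull y) u; rewrite lfunE /=; apply => // g i ip.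
  rewrite lfunE /= mulrA (HE_move hE hr) mulrBl -scalerAl mulrBl -mulrA -exprS.
  by rewrite memvB ?memvZ ?memvB ?sU // ltnW.
move=> u v uU vU.
have := @Uim (amulr v) u; rewrite lfunE /=; apply => // g i _.
rewrite lfunE /= -mulrA Ug //.
by elim: i => [|i IH]; rewrite ?expr0 ?mul1r // exprS -mulrA Uy.
Qed.

(** The span of free monomials is a subalgebra, and they are a basis
    of it. *)
Lemma HE_algebra_of_rel (B : falgType k) (phi : G -> B) (y : B) :
  HE_rel p a c alpha phi y -> free (HE_seq p phi y) ->
  exists (H : falgType k) (inc : G -> H) (x : H),
    HE_rel p a c alpha inc x /\ basis_of fullv (HE_seq p inc x).
Proof.
move=> hr fr; have [p1 pM pJ py] := hr.
pose U := (<<HE_seq p phi y>>)%VS.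
have sU g i : (i < p)%N -> phi g * y ^+ i \in U.
  move=> ip; apply: memv_span; apply: allpairs_f; rewrite ?mem_enum //.
  by rewrite mem_index_iota.
have Up g : phi g \in U by rewrite -[phi g]mulr1 -[1](expr0 y) sU // ltnW.
have Uy : y \in U by rewrite -[y]mul1r -[y]expr1 -p1 sU.
have U1 : 1 \in U by rewrite -p1.
have asU : is_aspace U.
  by rewrite /is_aspace has_algid1 //; apply/prodvP/(HE_span_mul hr).
pose A := ASpace asU.
pose inc g : subvs_of A := Subvs (Up g).
pose x : subvs_of A := Subvs Uy.
(* A subalgebra carries its own unit; here it is the ambient 1. *)
have alg1 : algid A = 1 by apply/eqP; rewrite algid_eq1.
have vX (u : subvs_of A) n : vsval (u ^+ n) = vsval u ^+ n.
  by elim: n => [|n IH]; rewrite ?expr0 // !exprS -IH.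
exists (subvs_of A), inc, x; split.
  split=> [|g h|g|]; apply: val_inj => /=.
  - by rewrite alg1.
  - exact: pM.
  - by rewrite alg1 pJ.
  - by rewrite vX py alg1.
have sz : size (HE_seq p inc x) = size (HE_seq p phi y).
  by rewrite /HE_seq !size_allpairs.
have dA : \dim (fullv : {vspace subvs_of A}) = size (HE_seq p inc x).
  by rewrite dimvf /dim /= sz; apply/eqP.
rewrite basisEdim dA leqnn andbT.
have im : (linfun vsval @: <<HE_seq p inc x>>)%VS = U.
  rewrite limg_span; congr span; rewrite map_allpairs; apply: eq_allpairs => // g i.
  by rewrite lfunE /= vX.
have le : (\dim U <= \dim <<HE_seq p inc x>>)%N.
  by rewrite -im -(limg_ker_dim (linfun vsval)) leq_addl.
suff -> : (<<HE_seq p inc x>> = fullv)%VS by rewrite subvf.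
apply/eqP; rewrite eqEdim subvf dA (leq_trans _ le) // sz.
by rewrite (eqnP fr).
Qed.

End Existence.

(** * A matrix model of the algebra *)

Section Model.
Variables (k : fieldType) (p : nat) (hp : p \in [pchar k]).
Variables (G : finGroupType) (a : G) (c : G -> k) (alpha : k).
Hypothesis hE : third_datum p a c.
Let p_gt1 : (1 < p)%N := prime_gt1 (pcharf_prime hp).

Local Notation T := (G * 'I_p)%type.
Local Notation n := (#|{: T}|.-1).

Let cardT : #|{: T}| = n.+1.
Proof. by rewrite prednK // card_prod card_ord muln_gt0 (ltnW p_gt1) -cardsT cardG_gt0. Qed.

Definition mono_rank (t : T) : 'I_n.+1 := cast_ord cardT (enum_rank t).
Definition mono_unrank (i : 'I_n.+1) : T := enum_val (cast_ord (esym cardT) i).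

Lemma mono_rankK : cancel mono_rank mono_unrank.
Proof. by move=> t; rewrite /mono_unrank /mono_rank cast_ordK enum_rankK. Qed.

Lemma mono_unrankK : cancel mono_unrank mono_rank.
Proof. by move=> i; rewrite /mono_unrank /mono_rank enum_valK cast_ordKV. Qed.

(** The basis vector standing for the monomial x^i g.  Writing x on the
    left makes the right action of G a permutation of the basis. *)
Definition mono (g : G) (i : nat) : 'rV[k]_n.+1 :=
  if insub i is Some j then delta_mx 0 (mono_rank (g, j)) else 0.

(** The matrix of the right action given by its values on monomials. *)
Definition opmx (F : G -> nat -> 'rV[k]_n.+1) : 'M[k]_n.+1 :=
  \matrix_(i < n.+1) F (mono_unrank i).1 (mono_unrank i).2.

Lemma opmxE F g i : (i < p)%N -> mono g i *m opmx F = F g i.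
Proof. by move=> ip; rewrite /mono insubT -rowE rowK mono_rankK. Qed.

Lemma opmx_eq (A B : 'M[k]_n.+1) :
  (forall g i, (i < p)%N -> mono g i *m A = mono g i *m B) -> A = B.
Proof.
move=> AB; apply/row_matrixP => i; rewrite !rowE -(mono_unrankK i).
case: (mono_unrank i) => g j; have := AB g j (ltn_ord j).
by rewrite /mono valK.
Qed.

Lemma mono_full (U : {vspace 'rV[k]_n.+1}) :
  (forall g i, (i < p)%N -> mono g i \in U) -> U = fullv.
Proof.
move=> hU; apply/vspaceP => v; rewrite memvf.
rewrite (row_sum_delta v); apply: memv_suml => i _; apply: memvZ.
rewrite -(mono_unrankK i); case: (mono_unrank i) => g j; have := hU g j (ltn_ord j).
by rewrite /mono valK.
Qed.

(** The vector of x^i g for i <= p, by the relation for x^p. *)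
Definition mono_top g i : 'rV[k]_n.+1 :=
  if (i < p)%N then mono g i else mono g 1 + alpha *: (mono (g * a ^+ p)%g 0 - mono g 0).

Definition actG (h : G) := opmx (fun g i => mono (g * h)%g i).
(** Left multiplication by x on the monomials x^i g.  It commutes with the
    right actions of G and of x. *)
Definition shift := opmx (fun g i => mono_top g i.+1).
Definition weight := opmx (fun g i => c g *: mono g i).
(** The right action of x: in H_E, [x^i g x = x^(i+1) g + c(g) x^i (a - 1) g]. *)
Definition actx := shift + weight * (actG a - 1).

Let p_gt0 := ltnW p_gt1.

Let cM : {morph c : g h / (g * h)%g >-> g + h}. Proof. by case: hE. Qed.

Let cap g : c (g * a ^+ p)%g = c g.
Proof.
rewrite cM; suff -> : c (a ^+ p)%g = 0 by rewrite addr0.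
have -> m : c (a ^+ m)%g = m%:R * c a.
  elim: m => [|m IH]; first by rewrite expg0 (datum1 hE) mul0r.
  by rewrite expgS cM IH mulrSr mulrDl mul1r addrC.
by rewrite (pcharf0 hp) mul0r.
Qed.

Lemma actG1 : actG 1%g = 1.
Proof. by apply: opmx_eq => g i ip; rewrite opmxE // mulg1 mulmx1. Qed.

Lemma actGM : {morph actG : g h / (g * h)%g >-> g * h}.
Proof.
move=> g h; apply: opmx_eq => g' i ip.
by rewrite mulmxA !opmxE // mulgA.
Qed.

Lemma shift_actG h : shift * actG h = actG h * shift.
Proof.
apply: opmx_eq => g i ip; rewrite !mulmxA !opmxE // /mono_top.
case: ltnP => [ip1|_]; first by rewrite opmxE.
rewrite mulmxDl -scalemxAl mulmxBl !opmxE //.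
have -> : (g * a ^+ p * h = g * h * a ^+ p)%g.
  by rewrite -!mulgA (commuteX p (esym (datum_commute hE h) : commute h a)).
by [].
Qed.

Lemma shift_weight : shift * weight = weight * shift.
Proof.
apply: opmx_eq => g i ip; rewrite !mulmxA !opmxE // -scalemxAl opmxE // /mono_top.
case: ltnP => [ip1|_]; first by rewrite opmxE.
by rewrite mulmxDl -scalemxAl mulmxBl !opmxE // cap -scalerBr [RHS]scalerDr !scalerA [alpha * _]mulrC.
Qed.

Lemma actG_weight h : actG h * weight = (weight + (c h)%:A) * actG h.
Proof.
apply: opmx_eq => g i ip; rewrite !mulmxA !opmxE // cM mulmxDr mulmxDl opmxE //.
by rewrite -scalemxAr mulmx1 -!scalemxAl !opmxE // scalerDl.
Qed.

(** Left and right multiplications commute. *)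
Lemma shift_actx : GRing.comm shift actx.
Proof.
apply: commrD; first exact: commr_refl.
by apply: commrM; [exact: shift_weight | apply: commrB; [exact: shift_actG | exact: commr1]].
Qed.

Lemma actG_actx h : actG h * actx = (actx + c h *: (actG a - 1)) * actG h.
Proof.
rewrite mulrDr -shift_actG mulrA actG_weight.
have La : actG h * (actG a - 1) = (actG a - 1) * actG h.
  by rewrite mulrBr mulrBl mulr1 mul1r -!actGM (datum_commute hE).
rewrite -mulrA La mulrA -mulrDl; congr (_ * _).
by rewrite mulrDl mulr_algl addrA.
Qed.

Let v0 := mono 1%g 0.

Lemma monoE g i : (i < p)%N -> mono g i = v0 *m (shift ^+ i * actG g).
Proof.
move=> ip; rewrite mulmxA.
have -> : v0 *m shift ^+ i = mono 1%g i.
  elim: i ip => [|i IH] ip; first by rewrite expr0 mulmx1.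
  by rewrite exprSr mulmxA IH 1?ltnW // opmxE 1?ltnW // /mono_top ip.
by rewrite opmxE // mul1g.
Qed.

Lemma v0_shift : v0 *m shift ^+ p = v0 *m (shift + alpha *: (actG (a ^+ p)%g - 1)).
Proof.
have vR : v0 *m shift ^+ p.-1 = mono 1%g p.-1.
  by rewrite monoE ?(prednK p_gt0) // actG1 mulr1.
have -> : shift ^+ p = shift ^+ p.-1 * shift by rewrite -exprSr (prednK p_gt0).
rewrite mulmxA vR opmxE ?(prednK p_gt0) // /mono_top ltnn.
by rewrite mulmxDr -scalemxAr mulmxBr mulmx1 !opmxE // /mono_top p_gt1.
Qed.

Lemma v0_actx m : v0 *m actx ^+ m = v0 *m shift ^+ m.
Proof.
have vC : v0 *m weight = 0 by rewrite opmxE // (datum1 hE) scale0r.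
have v1 : v0 *m actx = v0 *m shift by rewrite mulmxDr mulmxA vC mul0mx addr0.
elim: m => [|m IH]; first by rewrite !expr0.
rewrite exprSr mulmxA IH -mulmxA -[shift ^+ m *m actx](commrX m (commr_sym shift_actx)).
by rewrite mulmxA v1 -mulmxA -[shift *m _]/(shift * _) -exprS.
Qed.

(** Either a^p = 1 and the second factor vanishes, or c takes its values in the
    prime field. *)
Lemma datum_pow g : (c g ^+ p - c g) *: (actG a ^+ p - 1) = 0.
Proof.
have aX m : actG (a ^+ m)%g = actG a ^+ m.
  by elim: m => [|m IH]; rewrite ?expg0 ?actG1 // expgS actGM IH exprS.
have [_ _ _ _] := hE; have [ap _|/eqP ap /(_ ap g)[m ->]] := eqVneq (a ^+ p)%g 1%g.
  by rewrite -aX ap actG1 subrr scaler0.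
by rewrite -(pFrobenius_autE hp) pFrobenius_aut_nat subrr scale0r.
Qed.

(** Only the relation for [actx ^+ p] takes work.  Since [shift] commutes
    with everything, it is enough to test it on the vectors of g, where
    [skew_add_scalar_exp] moves it past g to the vector of 1; there [actx] acts
    as [shift], for which the relation holds by construction. *)
Lemma model_rel : HE_rel p a c alpha actG actx.
Proof.
have LV g : actG g * actG g^-1%g = 1 by rewrite -actGM mulgV actG1.
have VL g : actG g^-1%g * actG g = 1 by rewrite -actGM mulVg actG1.
split; [exact: actG1 | exact: actGM | |].
  by move=> g; rewrite actG_actx -mulrA LV mulr1.
set K := alpha *: (actG (a ^+ p)%g - 1).
have KR : GRing.comm shift K.
  by rewrite /GRing.comm /K -scalerAr -scalerAl mulrBr mulrBl mulr1 mul1r shift_actG.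
have KL g : K * actG g = actG g * K.
  rewrite /K -scalerAr -scalerAl mulrBr mulrBl mulr1 mul1r -!actGM; congr (_ *: (actG _ - _)).
  exact: (esym (commuteX p (esym (datum_commute hE g) : commute g a))).
set u := actG a - 1.
have Ru : GRing.comm shift u by apply: commrB; [exact: shift_actG | exact: commr1].
have uL : actG a \is a GRing.unit.
  by apply/unitrP; exists (actG a^-1%g); rewrite LV VL.
have skew : actG a * actx = (actx + u) * actG a.
  by rewrite actG_actx; case: hE => _ _ _ -> _; rewrite scale1r.
apply: opmx_eq => g i ip; rewrite monoE // -!mulmxA.
have LXn m : actG g * actx ^+ m = (actx + c g *: u) ^+ m * actG g.
  elim: m => [|m IH]; first by rewrite !expr0 mulr1 mul1r.
  by rewrite exprSr mulrA IH -mulrA actG_actx mulrA -exprSr.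
have Rc (Y : 'M[k]_n.+1) : GRing.comm shift Y -> shift ^+ i * (Y * actG g) = Y * (shift ^+ i * actG g).
  by move=> RY; rewrite !mulrA (commrX i (commr_sym RY)).
have Rcu : GRing.comm shift (c g *: u) by rewrite /GRing.comm -scalerAr Ru scalerAl.
have -> : shift ^+ i *m (actG g *m actx ^+ p) = (actx ^+ p + c g *: u) * (shift ^+ i * actG g).
  rewrite -[LHS]/(shift ^+ i * (actG g * _)) LXn.
  rewrite (skew_add_scalar_exp hp uL skew (datum_pow g)) Rc //.
  by apply: commrD => //; apply: commrX; apply: shift_actx.
have -> : shift ^+ i *m (actG g *m (actx + K)) = (actx + c g *: u + K) * (shift ^+ i * actG g).
  rewrite -[LHS]/(shift ^+ i * (actG g * _)) mulrDr actG_actx -KL -mulrDl Rc //.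
  by apply: commrD => //; apply: commrD => //; apply: shift_actx.
rewrite !mulmxA; congr (_ *m _ *m _).
have v0_actx1 : v0 *m actx = v0 *m shift := v0_actx 1.
rewrite [v0 *m (actx ^+ p + _)]mulmxDr v0_actx v0_shift [v0 *m (shift + _)]mulmxDr.
by rewrite [RHS]mulmxDr [v0 *m (actx + _)]mulmxDr v0_actx1 addrAC.
Qed.

(** The vector of 1 generates: its image under the span of the monomials is
    the whole space, whose dimension is the number of monomials. *)
Lemma model_free : free (HE_seq p actG actx).
Proof.
have rel := model_rel.
rewrite /free eqn_leq dim_span /=.
pose U := (<<HE_seq p actG actx>>)%VS.
have UM := HE_span_mul hp hE rel.
pose ev : 'Hom('M[k]_n.+1, 'rV[k]_n.+1) := linfun (mulmx v0).
have evE M : ev M = v0 *m M by rewrite lfunE.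
have sU g i : (i < p)%N -> actG g * actx ^+ i \in U.
  move=> ip; apply: memv_span; apply: allpairs_f; rewrite ?mem_enum //.
  by rewrite mem_index_iota.
have evU : (ev @: U)%VS = fullv.
  apply: mono_full => g i ip; rewrite monoE // mulmxA -v0_actx -mulmxA -evE memv_img //.
  apply: UM; first by rewrite -[_ ^+ _]mul1r -actG1 sU.
  by rewrite -[actG g]mulr1 -[1](expr0 actx) sU.
have := limg_ker_dim ev U; rewrite evU dimvf /dim /= => <-.
rewrite size_allpairs size_iota subn0 -cardE.
have -> : (#|G| * p = 1 * n.+1)%N by rewrite mul1n -cardT card_prod card_ord.
exact: leq_addl.
Qed.

Lemma HE_algebra_ex :
  exists (H : falgType k) (inc : G -> H) (x : H),
    HE_rel p a c alpha inc x /\ basis_of fullv (HE_seq p inc x).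
Proof. exact: (HE_algebra_of_rel hp hE model_rel model_free). Qed.

End Model.

(** * The coradical filtration of H_E *)

Section SkewExpansion.
Variables (k : fieldType) (H : falgType k) (a x : H).

(** The coefficient on the right of [x ^+ i] in
    [(x (x) a + 1 (x) x) ^+ n]; see [skew_expansion]. *)
Fixpoint right_coef n i : H :=
  if n is m.+1 then (if i is j.+1 then a * right_coef m j else 0) + x * right_coef m i
  else (i == 0)%:R.

Lemma right_coef_gt n i : (n < i)%N -> right_coef n i = 0.
Proof.
elim: n i => [|n IH] [|i] //= ni; rewrite (IH i) // (IH i.+1) ?(ltnW ni) //.
by rewrite !mulr0 addr0.
Qed.

Lemma right_coef_diag n : right_coef n n = a ^+ n.
Proof.
by elim: n => [|n IH] //=; rewrite IH (right_coef_gt (ltnSn n)) mulr0 addr0 exprS.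
Qed.

Lemma skew_expansion n N : (n < N)%N ->
  (tens x a + tens 1 x : tensor H H) ^+ n =
    \sum_(i < N) tens (x ^+ i) (right_coef n i).
Proof.
elim: n N => [|n IH] [|N] // nN.
  by rewrite big_ord_recl big1 ?addr0 // => i _; rewrite /= tens0r.
rewrite exprS (IH N.+1 (ltnW nN)) mulrDl !mulr_sumr.
rewrite big_ord_recr /= (right_coef_gt (nN : (n < N)%N)) tens0r mulr0 addr0.
rewrite [in RHS]big_ord_recl [X in _ + X]big_ord_recl addrCA /= add0r.
congr (_ + _); first by rewrite tens_mul mul1r.
rewrite -big_split; apply: eq_bigr => i _ /=.
by rewrite !tens_mul mul1r -exprS tensDr.
Qed.
End SkewExpansion.

Section Structure.
Variables (k : fieldType) (p : nat) (hp : p \in [pchar k]).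
Variables (G : finGroupType) (a : G) (c : G -> k) (alpha : k).
Hypothesis hE : third_datum p a c.
Variables (H : hopfType k) (inc : G -> H) (x : H).
Hypothesis hH : is_HE p a c alpha inc x.
Let p_gt1 : (1 < p)%N := prime_gt1 (pcharf_prime hp).
Let p_gt0 : (0 < p)%N := ltnW p_gt1.

Lemma is_HE_rel : HE_rel p a c alpha inc x.
Proof. by case: hH => *; split. Qed.

Lemma is_HE_basis : basis_of fullv (HE_seq p inc x).
Proof. by case: hH. Qed.

Let hb := is_HE_basis.
Let hr := is_HE_rel.
Let inc1 : inc 1%g = 1. Proof. by case: hH. Qed.
Let incM : {morph inc : g h / (g * h)%g >-> g * h}. Proof. by case: hH. Qed.

(** The coefficient functional of the monomial [inc g * x ^+ i]. *)
Definition coef g i : 'Hom(H, k^o) :=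
  projT1 (cid (HE_ext hb (fun h j => ((h == g) && (j == i))%:R : k^o))).

Lemma coefE g i h j : (j < p)%N ->
  coef g i (inc h * x ^+ j) = ((h == g) && (j == i))%:R.
Proof. exact: (projT2 (cid (HE_ext hb _))). Qed.

Lemma coef_sum v : v = \sum_g \sum_(i < p) (coef g i v : k) *: (inc g * x ^+ i).
Proof.
move: v; apply: (HE_ind hp hb) => [q u v eu ev|h j jp].
  rewrite {1}eu {1}ev scaler_sumr -big_split; apply: eq_bigr => g _ /=.
  rewrite scaler_sumr -big_split; apply: eq_bigr => i _ /=.
  by rewrite linearP scalerDl scalerA.
rewrite (bigD1 h) //= (bigD1 (Ordinal jp)) //= coefE // !eqxx scale1r.
rewrite !big1 ?addr0 // => [g gh|i ij].
  by rewrite big1 // => i _; rewrite coefE // eq_sym (negPf gh) scale0r.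
by rewrite coefE // eqxx /= eq_sym; move: ij; rewrite -val_eqE /= => /negPf->; rewrite scale0r.
Qed.

(** The elements of degree less than n in x; [fil 1] and [fil 2] will be
    H_0 and H_1. *)
Definition fil n : {vspace H} := span [seq inc g * x ^+ i | g <- enum G, i <- index_iota 0 n].

Lemma mem_fil n g i : (i < n)%N -> inc g * x ^+ i \in fil n.
Proof.
move=> im; apply: memv_span; apply: allpairs_f; rewrite ?mem_enum //.
by rewrite mem_index_iota.
Qed.

Lemma inc_fil n g : (0 < n)%N -> inc g \in fil n.
Proof. by move=> n0; rewrite -[inc g]mulr1 -[1](expr0 x) mem_fil. Qed.

Lemma fil_sub n (U : {vspace H}) :
  (forall g i, (i < n)%N -> inc g * x ^+ i \in U) -> (fil n <= U)%VS.
Proof.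
move=> hU; apply/span_subvP => _ /allpairsP[[g i] /= [_ + ->]].
by rewrite mem_index_iota; apply: hU.
Qed.

Lemma fil_coef0 n g i v : (n <= i < p)%N -> v \in fil n -> coef g i v = 0.
Proof.
move=> /andP[ni ip] vn; apply/eqP; rewrite -memv_ker.
apply: (subvP (fil_sub _)) vn => h j jn.
rewrite memv_ker coefE ?(leq_trans jn) ?(leq_trans ni) ?(ltnW ip) //.
by rewrite (ltn_eqF (leq_trans jn ni)) andbF.
Qed.

Lemma fil_sum n v : (n <= p)%N -> (forall g i, (n <= i < p)%N -> coef g i v = 0) ->
  v = \sum_g \sum_(i < n) (coef g i v : k) *: (inc g * x ^+ i).
Proof.
move=> np vn; rewrite {1}(coef_sum v); apply: eq_bigr => g _.
rewrite (big_ord_widen p (fun i => (coef g i v : k) *: (inc g * x ^+ i)) np) [RHS]big_mkcond.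
apply: eq_bigr => i _; case: ltnP => // ni.
by rewrite vn ?scale0r // ni ltn_ord.
Qed.

Lemma mem_filP n v : (n <= p)%N -> (forall g i, (n <= i < p)%N -> coef g i v = 0) ->
  v \in fil n.
Proof.
move=> np /(fil_sum np) ->; apply: memv_suml => g _; apply: memv_suml => i _.
by apply/memvZ/mem_fil.
Qed.

(** The map [f (x) id]; it sends the coproduct of an element of a
    subcoalgebra into that subcoalgebra. *)
Definition slice (f : 'Hom(H, k^o)) : 'Hom(tensor H H, H) :=
  tlift (fun u v => f u *: v).

Lemma sliceE f u v : slice f (tens u v) = f u *: v.
Proof. by apply: tliftE => [w|w] q z z'; rewrite linearP ?scalerDl ?scalerA. Qed.

Local Notation rc := (right_coef (inc a) x).

(** Only the monomials with group element [g] contribute, as the coproduct of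
    [inc h * x ^+ n] has its left factors in [inc h * k[x] ]. *)
Lemma slice_comul g m v : (m < p)%N ->
  slice (coef g m) (comul v) = \sum_(n < p) (coef g n v : k) *: (inc g * rc n m).
Proof.
move=> mp; rewrite {1}(coef_sum v) linear_sum linear_sum /= (bigD1 g) //=.
(* In the expansion, only the term of index m has x^m on its left. *)
have term h (n : 'I_p) : slice (coef g m) (comul (inc h * x ^+ n)) =
    (h == g)%:R *: (inc h * rc n m).
  rewrite (HE_comul hH) ?(ltn_ord n) // (skew_expansion _ _ (ltn_ord n)) mulr_sumr.
  rewrite linear_sum (bigD1 (Ordinal mp)) //= big1 ?addr0.
    by rewrite tens_mul sliceE coefE // eqxx andbT.
  move=> i im; rewrite tens_mul sliceE coefE //.
  by move: im; rewrite -val_eqE /= => /negPf->; rewrite andbF scale0r.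
rewrite [X in _ + X]big1 ?addr0 => [|h hg]; last first.
  rewrite linear_sum linear_sum big1 // => n _.
  by rewrite !linearZ /= term (negPf hg) scale0r scaler0.
rewrite linear_sum linear_sum; apply: eq_bigr => n _.
by rewrite !linearZ /= term eqxx scale1r.
Qed.

(** The leading monomial of a nonzero element. *)
Lemma fil_degree v : v != 0 -> exists g n,
  [/\ (n < p)%N, coef g n v != 0 & v \in fil n.+1].
Proof.
move=> v0; pose P n := (n < p)%N && [exists g, coef g n v != 0].
have exP : exists n, P n.
  apply: contrapT => nP; move/eqP: v0; apply; rewrite (coef_sum v).
  rewrite big1 // => g _; rewrite big1 // => i _.
  have [->|ci] := eqVneq (coef g i v) 0; first by rewrite scale0r.
  by case: nP; exists i; rewrite /P ltn_ord; apply/existsP; exists g.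
case: (ex_maxnP exP (fun n Pn => ltnW (proj1 (andP Pn)))) => n /andP[np /existsP[g cg]] maxn.
exists g, n; split=> //; apply: mem_filP => // h i /andP[ni ip].
apply/eqP; apply: contraLR ni => ci; rewrite -ltnNge ltnS maxn // /P ip.
by apply/existsP; exists h.
Qed.

Lemma slice_tensv (f : 'Hom(H, k^o)) (U V : {vspace H}) t :
  t \in tensv U V -> slice f t \in V.
Proof.
suff /subvP s : (tensv U V <= slice f @^-1: V)%VS by move=> /s; rewrite -memv_preim.
apply: vspan_sub => _ [u [v [uU vV ->]]].
by rewrite -memv_preim sliceE memvZ.
Qed.

Lemma mem_tensv (U V : {vspace H}) u v :
  u \in U -> v \in V -> tens u v \in tensv U V.
Proof. by move=> uU vV; apply: memv_vspan; exists u, v. Qed.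

Lemma comul_inc g : comul (inc g) = tens (inc g) (inc g).
Proof. by have := HE_comul hH g p_gt0; rewrite !expr0 !mulr1. Qed.

Lemma comul_incx g :
  comul (inc g * x) = tens (inc g * x) (inc g * inc a) + tens (inc g) (inc g * x).
Proof.
have := HE_comul hH g p_gt1; rewrite !expr1 => ->.
by rewrite mulrDr !tens_mul mulr1.
Qed.

Lemma counit_inc g : counit (inc g) = 1.
Proof. by have := HE_counit hH g p_gt0; rewrite expr0 mulr1. Qed.

Lemma inc_neq0 g : inc g != 0.
Proof. by apply/eqP => g0; have := HE_unit hr g; rewrite g0 unitr0. Qed.

(** If [g x^n] is a leading monomial of an element of the subcoalgebra, then
    slicing its coproduct at this monomial leaves a multiple of g a^n. *)
Lemma subcoalgebra_grouplike (U : {vspace H}) :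
  subcoalgebra U -> U <> 0%VS -> exists g, inc g \in U.
Proof.
move=> sU nzU; have [v vU v0] : exists2 v, v \in U & v != 0.
  exists (vpick U); first exact: memv_pick.
  by rewrite vpick0; apply/eqP.
have [g [n [np cg vn]]] := fil_degree v0.
exists (g * a ^+ n)%g.
have : slice (coef g n) (comul v) \in U.
  apply: (@slice_tensv _ U); apply: (subvP sU); exact: memv_img.
rewrite slice_comul // (bigD1 (Ordinal np)) //= big1 ?addr0 => [|i /eqP ni].
  rewrite right_coef_diag -(HE_phiX hr) -incM => inU.
  have := memvZ (coef g n v : k)^-1 inU; rewrite scalerA mulVf ?scale1r //.
have [lt|lt|ein] := ltngtP i n; last by case: ni; apply: val_inj.
  by rewrite right_coef_gt // mulr0 scaler0.
by rewrite (fil_coef0 _ _ vn) ?scale0r // lt ltn_ord.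
Qed.

Lemma subcoalgebra_line g : subcoalgebra <[inc g]>%VS.
Proof.
rewrite /subcoalgebra limg_line comul_inc -memvE.
by apply: mem_tensv; apply: memv_line.
Qed.

Lemma simple_subcoalgebraP (U : {vspace H}) :
  simple_subcoalgebra U <-> exists g, U = <[inc g]>%VS.
Proof.
split=> [[sU nzU minU]|[g ->]].
  have [g gU] := subcoalgebra_grouplike sU nzU; exists g.
  have [|/eqP|//] := minU _ (subcoalgebra_line g) _; first by rewrite -memvE.
  by rewrite -dimv_eq0 dim_vline inc_neq0.
have dg : \dim <[inc g]>%VS = 1%N by rewrite dim_vline inc_neq0.
split; [exact: subcoalgebra_line | |].
  by move/eqP; rewrite -dimv_eq0 dg.
move=> W _ WU; have := dimvS WU; rewrite dg leq_eqVlt ltnS leqn0 dimv_eq0.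
by case/orP=> [/eqP dW|/eqP]; [right | left] => //; apply/eqP; rewrite eqEdim WU dg dW.
Qed.

Lemma HE_pointed : pointed H.
Proof.
by move=> U /simple_subcoalgebraP[g ->]; rewrite dim_vline inc_neq0.
Qed.

Lemma HE_coradical : coradical H = fil 1.
Proof.
apply/eqP; rewrite eqEsubv; apply/andP; split.
  apply: vspan_sub => v [U [/simple_subcoalgebraP[g ->]]]; apply/subvP.
  by rewrite -memvE inc_fil.
apply: fil_sub => g [|//] _; rewrite expr0 mulr1; apply: memv_vspan.
exists <[inc g]>%VS; split; last exact: memv_line.
by apply/simple_subcoalgebraP; exists g.
Qed.

Lemma fil_mulg g n v : (n <= p)%N -> v \in fil n -> inc g * v \in fil n.
Proof.
move=> np vn; suff /subvP : (fil n <= amull (inc g) @^-1: fil n)%VS.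
  by move=> /(_ v vn); rewrite -memv_preim lfunE.
by apply: fil_sub => h i ip; rewrite -memv_preim lfunE /= mulrA -incM mem_fil.
Qed.

(** Of the words with n letters [x (x) a] and one letter [1 (x) x], each
    contributes a^n x, modulo kG. *)
Lemma right_coef_sub n : exists2 z, z \in fil 1 &
  right_coef (inc a) x n.+1 n = n.+1%:R *: (inc (a ^+ n)%g * x) + z.
Proof.
elim: n => [|n [z z0 IH]].
  exists 0; first exact: mem0v.
  by rewrite /= add0r mulr1 addr0 scale1r expg0 inc1 mul1r.
exists (inc a * z - c (a ^+ n.+1)%g *: (inc (a ^+ n.+1 * a)%g - inc (a ^+ n.+1)%g)).
  by apply: memvB; [apply: fil_mulg | rewrite memvZ // memvB // inc_fil].
rewrite [LHS]/= -/(right_coef (inc a) x n.+1 n) -/(right_coef (inc a) x n.+1 n.+1).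
rewrite IH right_coef_diag -(HE_phiX hr) (HE_move hE hr).
rewrite mulrDr -scalerAr mulrA -incM -expgS [n.+2%:R]mulrSr scalerDl scale1r.
by rewrite -!addrA; congr (_ + _); rewrite addrCA.
Qed.

(** Suppose that the leading degree of an element of H_1 is m + 1 with m > 0.
    Slicing its coproduct in degree m and taking the coefficient of g a^m x kills
    both H (x) kG and kG (x) H, but gives m + 1 times the leading coefficient. *)
Lemma HE_coradical1 : coradical1 H = fil 2.
Proof.
rewrite /coradical1 HE_coradical; apply/eqP; rewrite eqEsubv; apply/andP; split.
  apply/subvP => v; rewrite -memv_preim => dv.
  have [->|v0] := eqVneq v 0; first exact: mem0v.
  have [g [n [np cg vn]]] := fil_degree v0.
  have [n2|n2] := leqP n.+1 2.
    apply: subvP vn; apply: fil_sub => h i ni; apply: mem_fil.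
    exact: leq_trans ni n2.
  case: n n2 np cg vn => [//|m] m1 mp cg vn; case/negP: cg.
  have {}m1 : (0 < m)%N by [].
  pose w := slice (coef g m) (comul v).
  have w0 : coef (g * a ^+ m)%g 1 w = 0.
    move: dv => /memv_addP[s sf [t tf stE]]; rewrite /w stE linearD linearD /=.
    (* The coefficient of g x^m vanishes on kG because m > 0. *)
    have slice0 : (tensv (fil 1) fullv <= lker (slice (coef g m)))%VS.
      apply: vspan_sub => _ [u [u' [uf _ ->]]]; rewrite memv_ker sliceE.
      by rewrite (fil_coef0 _ _ uf) ?scale0r // m1 ltnW.
    have /subvP/(_ _ tf) := slice0; rewrite memv_ker => /eqP ->.
    rewrite linear0 addr0; apply: (@fil_coef0 1); first by rewrite p_gt1.
    exact: slice_tensv sf.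
  have wE : w = (coef g m v : k) *: inc (g * a ^+ m)%g +
      (coef g m.+1 v : k) *: (inc g * right_coef (inc a) x m.+1 m).
    rewrite /w slice_comul ?(ltnW mp) // (bigD1 (Ordinal (ltnW mp))) //=.
    rewrite (bigD1 (Ordinal mp)) /=; last by rewrite -val_eqE /= gtn_eqF.
    rewrite right_coef_diag -(HE_phiX hr) -incM big1 ?addr0 // => i /andP[/eqP i1 /eqP i2].
    have [lt|lt|ein] := ltngtP i m.
    - by rewrite right_coef_gt // mulr0 scaler0.
    - have lt2 : (m.+1 < i)%N.
        by rewrite ltn_neqAle lt andbT; apply/eqP => e; case: i2; apply: val_inj.
      by rewrite (fil_coef0 _ _ vn) ?scale0r // lt2 ltn_ord.
    - by case: i1; apply: val_inj.
  have [z zf rE] := right_coef_sub m.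
  move: w0; rewrite wE rE linearD !linearZ /= mulrDr linearD -scalerAr linearZ /=.
  rewrite (fil_coef0 _ _ (fil_mulg g p_gt0 zf)) ?p_gt1 // addr0.
  rewrite (fil_coef0 _ _ (inc_fil _ (ltnSn 0))) ?p_gt1 // scaler0 add0r.
  rewrite mulrA -incM -[x]expr1 coefE // !eqxx => /eqP; rewrite !scaler_eq0 oner_eq0 orbF.
  case/orP=> // /eqP m0; have := dvdn_pcharf hp m.+1; rewrite m0 eqxx => /(dvdn_leq (ltn0Sn m)).
  by rewrite leqNgt mp.
apply: fil_sub => g [|[|//]] _; rewrite -memv_preim.
  rewrite expr0 mulr1 comul_inc; apply: (subvP (addvSl _ _)).
  by apply: mem_tensv; rewrite ?memvf // inc_fil.
rewrite expr1 comul_incx; apply: memv_add; apply: mem_tensv; rewrite ?memvf //.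
  by rewrite -incM inc_fil.
by rewrite inc_fil.
Qed.

(** Identify the tensor product of k and H with H.  The relations then become
    the differences [h v - epsilon(h) v], which span the kernel in H_1 of the
    map [g x^i |-> x^i] onto a plane. *)
Lemma HE_rank : has_rank H 1.
Proof.
pose j : 'Hom(tensor (k^o : vectType k) H, H) := tlift (fun (l : k^o) v => (l : k) *: v).
have jE (l : k^o) v : j (tens l v) = (l : k) *: v.
  by apply: tliftE => [w|w] q z z'; rewrite ?scalerDr ?scalerDl ?scalerA // mulrC.
have jinj : lker j == 0%VS.
  apply/lker0P => s t; apply: can_inj (fun v => tens (1 : k^o) v) _ s t.
  elim/tensor_ind => [q s t es et|l v].
    by rewrite linearP tensDr tensZr es et.
  by rewrite jE tensZr -tensZl; congr (tens _ v); rewrite /GRing.scale /= mulr1.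
have jdim U : \dim (j @: U)%VS = \dim U.
  by apply: limg_dim_eq; rewrite (eqP jinj) capv0.
have [f fE] := HE_ext hb (fun _ i => delta_mx 0 (inord i) : 'rV[k]_2).
(* On H_1, f sends g x^i to the i-th unit vector of the plane; B is the space of the relations. *)
pose B := (fil 2 :&: lker f)%VS.
have fg g v : f (inc g * v) = f v.
  suff /lfunP/(_ v) : (f \o amull (inc g))%VF = f by rewrite comp_lfunE lfunE.
  by apply: (HE_eq hb) => h i ip; rewrite comp_lfunE lfunE /= mulrA -incM !fE.
have j_sub U V : (U <= j @^-1: V)%VS -> (j @: U <= V)%VS.
  move=> UV; apply/subvP => _ /memv_imgP[t tU ->].
  by rewrite memv_preim (subvP UV).
have jT : (j @: tensv (fullv : {vspace k^o}) (fil 2))%VS = fil 2.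
  apply/eqP; rewrite eqEsubv; apply/andP; split.
    apply/j_sub/vspan_sub => _ [l [v [_ vf ->]]].
    by rewrite -memv_preim jE memvZ.
  apply/subvP => v vf; rewrite -[v]scale1r -(jE (1 : k^o)) memv_img //.
  by apply: memv_vspan; exists (1 : k^o), v; rewrite memvf.
have jB : (j @: balancing H)%VS = B.
  apply/eqP; rewrite eqEsubv; apply/andP; split.
    apply/j_sub/vspan_sub => _ [l [h [v [+ + ->]]]].
    rewrite HE_coradical HE_coradical1 -memv_preim => hf vf.
    have {hf} hE' : h = \sum_g (coef g 0 h : k) *: inc g.
      rewrite {1}(@fil_sum 1 h) // => [|g i ip]; last exact: (fil_coef0 _ ip hf).
      by apply: eq_bigr => g _; rewrite big_ord1 expr0 mulr1.
    rewrite linearB /= !jE -scalerA -scalerBr memvZ //.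
    rewrite hE' linear_sum mulr_suml scaler_suml -sumrB memv_suml // => g _.
    rewrite linearZ /= counit_inc -scalerAl /GRing.scale /= mulr1.
    rewrite -scalerBr memvZ // memv_cap memvB ?fil_mulg //=.
    by rewrite memv_ker linearB /= fg subrr.
  apply/subvP => v /memv_capP[vf]; rewrite memv_ker => /eqP fv.
  have vE := fil_sum p_gt1 (fun g i ip => fil_coef0 g ip vf).
  have S0 (i : 'I_2) : \sum_g (coef g i v : k) = 0.
    suff <- : f v 0 i = \sum_g (coef g i v : k) by rewrite fv mxE.
    rewrite {1}vE linear_sum summxE.
    apply: eq_bigr => g _; rewrite linear_sum summxE (bigD1 i) //= big1 ?addr0.
      rewrite linearZ /= fE ?(leq_trans (ltn_ord i)) // !mxE inord_val !eqxx.
      by rewrite mulr1.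
    move=> i' ii'; rewrite linearZ /= fE ?(leq_trans (ltn_ord i')) // !mxE inord_val.
    by rewrite eq_sym (negPf ii') mulr0.
  have -> : v = \sum_(i < 2) \sum_g (coef g i v : k) *: (inc g * x ^+ i - x ^+ i).
    rewrite {1}vE exchange_big; apply: eq_bigr => i _.
    under [RHS]eq_bigr do rewrite scalerBr.
    by rewrite sumrB -scaler_suml S0 scale0r subr0.
  apply: memv_suml => i _; apply: memv_suml => g _; apply: memvZ.
  have -> : inc g * x ^+ i - x ^+ i = - j (tens (1 * counit (inc g)) (x ^+ i) -
      tens 1 (inc g * x ^+ i)).
    by rewrite linearB /= !jE counit_inc mulr1 !scale1r opprB.
  rewrite memvN memv_img //; apply: memv_vspan; exists 1, (inc g), (x ^+ i).
  rewrite HE_coradical HE_coradical1; split=> //; first exact: inc_fil.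
  by rewrite -[x ^+ i]mul1r -inc1 mem_fil.
rewrite /has_rank -jdim HE_coradical1 jT -[in RHS]jdim jB -(limg_ker_dim f (fil 2)).
congr (_ + _)%N.
have -> : (f @: fil 2)%VS = fullv.
  apply/vspaceP => v; rewrite memvf (row_sum_delta v) memv_suml // => i _.
  apply: memvZ; have ip := leq_trans (ltn_ord i) p_gt1.
  by rewrite -[i]inord_val -(fE 1%g i ip) memv_img ?mem_fil.
by rewrite dimvf.
Qed.

Lemma HE_third_type : third_type H.
Proof.
have x1 : x \notin fil 1.
  apply/negP => xf; have := @fil_coef0 1 1%g 1 x; rewrite p_gt1 => /(_ isT xf) /eqP.
  have := coefE 1%g 1 1%g p_gt1; rewrite inc1 mul1r expr1 !eqxx => ->.
  by rewrite oner_eq0.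
have Dx : comul x = tens x (inc a) + tens 1 x.
  by have := comul_incx 1%g; rewrite inc1 !mul1r.
have ca : c a = 1 by case: hE.
split; [exact: HE_pointed | exact: HE_rank | | ].
  have gen v : v \in fil 2 -> v \in agenv (coradical1 H).
    by rewrite HE_coradical1; apply/subvP/sub_agenv.
  apply/vspaceP => v; rewrite memvf (coef_sum v) memv_suml // => g _.
  rewrite memv_suml // => i _; apply: memvZ; elim: (i : nat) => [|m IH].
    by rewrite expr0 mulr1 gen // inc_fil.
  rewrite exprSr mulrA memvM // gen //.
  by rewrite -[x]mul1r -[x in _ * x]expr1 -inc1 mem_fil.
exists (inc a); split.
- split; first by split; [exact: comul_inc | exact: counit_inc].
  by exists x; [rewrite /skew_primitive | rewrite HE_coradical].
- move=> a1; have /eqP := coefE 1%g 0 a p_gt0.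
  rewrite expr0 mulr1 a1 -inc1 -[inc 1%g]mulr1 -[1](expr0 x) coefE // !eqxx andbT.
  have [a1'|_] := eqVneq a 1%g; last by rewrite oner_eq0.
  by case: hE => _ + _ _ _; rewrite a1' order1 dvdn1 gtn_eqF.
- exists x; split; [by rewrite /skew_primitive | by rewrite HE_coradical |].
  by rewrite (HE_inv hr); case: hr => _ _ -> _; rewrite ca scale1r.
Qed.

End Structure.

Theorem lemma4p16 (k : fieldType) (p : nat) (hp : p \in [pchar k])
    (G : finGroupType) (a : G) (c : G -> k) (alpha : k)
    (hE : third_datum p a c) :
  (exists (H : hopfType k) (inc : G -> H) (x : H), is_HE p a c alpha inc x) /\
  (forall (H : hopfType k) (inc : G -> H) (x : H), is_HE p a c alpha inc x ->
    [/\ pointed H, has_rank H 1%N & third_type H]).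
Proof.
split=> [|H inc x hH].
  have [H [inc [x [hr hb]]]] := HE_algebra_ex hp alpha hE.
  exact: (HE_hopf_ex hp hE hr hb).
by split; [apply: (HE_pointed hp hH) | apply: (HE_rank hp hE hH) | apply: (HE_third_type hp hE hH)].
Qed.
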